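(* Let $P=\{X_s\}_{s\in S}$ be a partition of the nonempty set $X$, and let $K\in\mathfrak K^h_P(X;\boldsymbol H)$. The following assertions are equivalent. (1) There exists $L\in\mathfrak K^+_P(X;\boldsymbol H)$ such that $-L\le_P K\le_P L$. (1)$'$ There exists $L\in\mathfrak K^+_P(X;\boldsymbol H)$ such that $K\le_P L$. (2) There exists $L\in\mathfrak K^+_P(X;\boldsymbol H)$ such that, for each $s\in S$, $$|[f,g]_K|\le[f,f]_L^{1/2}\,[g,g]_L^{1/2},\quad f,g\in\mathcal F^0_{\mathbb F}(X_s;\boldsymbol H_s).$$ (3) $K=K_1-K_2$ for some $K_1,K_2\in\mathfrak K^+_P(X;\boldsymbol H)$. (3)$'$ $K=K_1-K_2$ for some disjoint $K_1,K_2\in\mathfrak K^+_P(X;\boldsymbol H)$. (4) There exists a pair $(\boldsymbol K;\boldsymbol V)$ with the following properties: (LL1) $\boldsymbol K=\{\mathcal K_s\}_{s\in S}$ is a bundle of Krein spaces. (LL2) $\boldsymbol V=\{V_x\}_{x\in X}$ is a bundle of bounded linear operators, $V_x\colon\mathcal H_x\to\mathcal K_{a(x)}$ for each $x\in X$, such that, for all $s\in S$ and all $x,y\in X_s$, $K(x,y)=V_x^*J_sV_y$, where $J_s$ is a fixed, but otherwise arbitrary, fundamental symmetry of $\mathcal K_s$; equivalently, $\langle K(x,y)k,h\rangle_{\mathcal H_x}=[V_yk,V_xh]_{\mathcal K_s}$ for all $h\in\mathcal H_x$, $k\in\mathcal H_y$. (LL3) For each $s\in S$, the Krein space $\mathcal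 K_s$ is the closed span of $\{V_x\mathcal H_x\mid x\in X,\ a(x)=s\}$. (5) There exists a Krein space bundle $\boldsymbol R=\{\mathcal R_{K^s}\}_{s\in S}$, where, for each $s\in S$, $K^s=K|_{X_s\times X_s}$ and $\mathcal R_{K^s}$ is a reproducing kernel $\boldsymbol H_s$-valued Krein space with $\boldsymbol H_s$-operator valued reproducing kernel $K^s$.
   Context: $\mathbb F$ is $\mathbb R$ or $\mathbb C$. $\boldsymbol H=\{\mathcal H_x\}_{x\in X}$ is a bundle (family) of Hilbert spaces over $\mathbb F$; $\boldsymbol H_s=\{\mathcal H_x\}_{x\in X_s}$. For $x\in X$, $a(x)$ denotes the unique $s\in S$ with $x\in X_s$ (the $X_s$ are nonempty). An $\boldsymbol H$-operator valued kernel $K$ on $X$ is a map on $X\times X$ with $K(x,y)\in\mathcal B(\mathcal H_y,\mathcal H_x)$. $\mathcal F_{\mathbb F}(X_s;\boldsymbol H_s)=\prod_{x\in X_s}\mathcal H_x$ is the vector space of sections ($f(x)\in\mathcal H_x$) and $\mathcal F^0_{\mathbb F}(X_s;\boldsymbol H_s)$ its subspace of finitely supported sections. For $f,g\in\mathcal F^0_{\mathbb F}(X_s;\boldsymbol H_s)$, $[f,g]_K=\sum_{x,y\in X_s}\langle K(y,x)f(x),g(y)\rangle_{\mathcal H_y}$. $\mathfrak K^h_P(X;\boldsymbol H)$ is the real vector space of $\boldsymbol H$-operator valued kernels on $X$ that are partially Hermitian with respect to $P$: $K(x,y)^*=K(y,x)$ for all $s\in S$, $x,y\in X_s$. $\mathfrak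 K^+_P(X;\boldsymbol H)$ is the convex cone of kernels $K\in\mathfrak K^h_P(X;\boldsymbol H)$ that are partially positive semidefinite with respect to $P$: for every $s\in S$, $n\in\mathbb N$, $x_1,\dots,x_n\in X_s$, $h_i\in\mathcal H_{x_i}$, $\sum_{i,j=1}^n\langle K(x_j,x_i)h_i,h_j\rangle_{\mathcal H_{x_j}}\ge0$. (No condition is imposed on $K(x,y)$ for $x,y$ in different blocks.) For $K,L\in\mathfrak K^h_P(X;\boldsymbol H)$, $K\le_PL$ means $L-K\in\mathfrak K^+_P(X;\boldsymbol H)$. $L_1,L_2\in\mathfrak K^+_P(X;\boldsymbol H)$ are disjoint if whenever $L\in\mathfrak K^+_P(X;\boldsymbol H)$ satisfies $L\le_PL_1$ and $L\le_PL_2$, then $L|_{X_s\times X_s}=0$ for all $s\in S$. A Krein space is an $\mathbb F$-vector space $\mathcal K$ with a (conjugate) symmetric sesquilinear/bilinear form $[\cdot,\cdot]$, linear in the first variable, for which there is a linear operator $J$ on $\mathcal K$ (a fundamental symmetry) with $J^2=I$ such that $\langle x,y\rangle_J=[Jx,y]$ is a positive definite inner product making $\mathcal K$ a Hilbert space; all fundamental symmetries give the same (strong) topology, with respect to which boundedness and closures are understood. In (LL2), $V_x^*$ is the Hilbert space adjoint with respect to $\langle\cdot,\cdot\rangle_{J_s}$ on $\mathcal K_s$. A reproducing kernel $\boldsymbol H_s$-valued Krein space with kernel $K^s$ is a Krein space $(\mathcal R;[\cdot,\cdot])$ such that $\mathcal R$ is a linear subspace of $\mathcal F_{\mathbb F}(X_s;\boldsymbol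 H_s)$, $K^s_xh:=K^s(\cdot,x)h\in\mathcal R$ for all $x\in X_s$, $h\in\mathcal H_x$, and $\langle f(x),h\rangle_{\mathcal H_x}=[f,K^s_xh]$ for all $f\in\mathcal R$, $x\in X_s$, $h\in\mathcal H_x$. *)

(* Defs.v *)
From HB Require Import structures.
From mathcomp Require Import all_boot all_order all_algebra.
From mathcomp Require Import complex ring.
From mathcomp Require Import all_classical all_reals all_analysis.

Set Implicit Arguments.
Unset Strict Implicit.
Unset Printing Implicit Defensive.

Import Order.TTheory GRing.Theory Num.Theory.
Import numFieldNormedType.Exports.

Local Open Scope classical_set_scope.
Local Open Scope ring_scope.

Variant scalar_kind := RealScalars | ComplexScalars.

Definition scalarField (R : realType) (k : scalar_kind) : numFieldType :=
  match k with RealScalars => R | ComplexScalars => R[i] end.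

Definition sconj (R : realType) (k : scalar_kind) :
    {rmorphism scalarField R k -> scalarField R k} :=
  match k return {rmorphism scalarField R k -> scalarField R k} with
  | RealScalars => idfun
  | ComplexScalars => (Num.conj : {rmorphism R[i] -> R[i]})
  end.

(* Only meant for nonnegative scalars. The order on [R[i]] is the partial one:
   [0 <= z] says that [z] is real and nonnegative. *)
Definition ssqrt (R : realType) (k : scalar_kind) : scalarField R k -> scalarField R k :=
  match k return scalarField R k -> scalarField R k with
  | RealScalars => @Num.sqrt R
  | ComplexScalars => fun z : R[i] => sqrtC z
  end.

Section ScalarTheory.
Variables (R : realType) (k : scalar_kind).
Implicit Types x : scalarField R k.

Lemma ssqrt_ge0 x : 0 <= x -> 0 <= ssqrt x.
Proof.
by case: k x => x x0 /=; [exact: sqrtr_ge0 | rewrite sqrtC_ge0].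
Qed.

Lemma sqr_ssqrt x : 0 <= x -> ssqrt x ^+ 2 = x.
Proof. by case: k x => x x0 /=; [exact: sqr_sqrtr | exact: sqrtCK]. Qed.

Lemma sconjK : involutive (@sconj R k).
Proof. by case: k => x //=; rewrite conjCK. Qed.

Lemma mul_sconj x : x * sconj R k x = `|x| ^+ 2.
Proof.
by case: k x => x /=; [rewrite real_normK ?num_real// expr2 | rewrite -normCK].
Qed.

Lemma addr_sconj_le x : x + sconj R k x <= `|x| *+ 2.
Proof.
case: k x => x /=; first by rewrite -mulr2n lerMn2r ler_norm.
have [xR _] := leif_Re_Creal x.
by rewrite ReE ler_pdivrMr ?ltr0n// mulr_natr in xR.
Qed.

End ScalarTheory.

(* [V] with the norm [v |-> <v, v>^(1/2)] of the inner product [ip]. *)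
Definition normed_by (R : realType) (k : scalar_kind) (V : lmodType (scalarField R k))
  (ip : {dot V for @sconj R k}) : Type := V.

Section NormedBy.
Variables (R : realType) (k : scalar_kind) (V : lmodType (scalarField R k)).
Variable ip : {dot V for @sconj R k}.
Local Notation F := (scalarField R k).
Implicit Types x y : V.

Lemma ipC x y : ip x y = sconj R k (ip y x).
Proof. by rewrite hermC expr0 mul1r. Qed.

Lemma ip_ge0 x : 0 <= ip x x.
Proof.
have [->|x0] := eqVneq x 0; first by rewrite linear0l.
exact/ltW/neq0_dnorm_gt0.
Qed.

Lemma ip_eq0 x : ip x x = 0 -> x = 0.
Proof.
by move=> xx0; apply: contra_eq (xx0) => /(neq0_dnorm_gt0 (s := ip) x); rewrite lt0r => /andP[].
Qed.

Lemma ipZ (l : F) x : ip (l *: x) (l *: x) = `|l| ^+ 2 * ip x x.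
Proof. by rewrite linearZl_LR linearZr_LR /= mulrA mul_sconj. Qed.

Lemma cauchy_schwarz x y : `|ip x y| ^+ 2 <= ip x x * ip y y.
Proof.
have [->|y0] := eqVneq y 0; first by rewrite !linear0r normr0 expr0n.
have yy : 0 < ip y y := neq0_dnorm_gt0 (s := ip) y y0.
have rP : sconj R k (ip y y) = ip y y by rewrite -ipC.
have := ip_ge0 (ip y y *: x - ip x y *: y).
rewrite linearBl !linearBr !linearZl_LR /= !linearZr_LR /= rP -(ipC y x).
rewrite /GRing.scale /=.
have -> : ip y y * (ip y y * ip x x) - ip y x * (ip y y * ip x y) -
    (ip y y * (ip x y * ip y x) - ip y x * (ip x y * ip y y)) =
    ip y y * (ip x x * ip y y - ip x y * ip y x) by ring.
by rewrite pmulr_rge0// [ip y x]ipC mul_sconj subr_ge0.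
Qed.

Definition ip_norm (x : V) : F := ssqrt (ip x x).

Lemma ip_norm_ge0 x : 0 <= ip_norm x.
Proof. exact/ssqrt_ge0/ip_ge0. Qed.

Lemma sqr_ip_norm x : ip_norm x ^+ 2 = ip x x.
Proof. exact/sqr_ssqrt/ip_ge0. Qed.

Lemma ip_norm0_eq0 x : ip_norm x = 0 -> x = 0.
Proof. by move=> x0; apply: ip_eq0; rewrite -sqr_ip_norm x0 expr0n. Qed.

Lemma ip_normZ (l : F) x : ip_norm (l *: x) = `|l| * ip_norm x.
Proof.
apply/eqP; rewrite -(eqrXn2 (isT : 0 < 2)%N) ?mulr_ge0 ?ip_norm_ge0//.
by rewrite exprMn !sqr_ip_norm ipZ.
Qed.

Lemma ler_ip_normD x y : ip_norm (x + y) <= ip_norm x + ip_norm y.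
Proof.
rewrite -(ler_pXn2r (isT : 0 < 2)%N) ?nnegrE ?addr_ge0 ?ip_norm_ge0//.
rewrite sqrrD !sqr_ip_norm linearDl !linearDr /= addrA lerD2r -!addrA lerD2l.
rewrite [ip y x]ipC (le_trans (addr_sconj_le _))// lerMn2r /=.
rewrite -(ler_pXn2r (isT : 0 < 2)%N) ?nnegrE ?mulr_ge0 ?ip_norm_ge0//.
by rewrite exprMn !sqr_ip_norm cauchy_schwarz.
Qed.

HB.instance Definition _ := GRing.Lmodule.on (normed_by ip).
HB.instance Definition _ := @Lmodule_isNormed.Build F (normed_by ip)
  ip_norm ler_ip_normD ip_normZ ip_norm0_eq0.

End NormedBy.

Definition ip_complete (R : realType) (k : scalar_kind)
    (V : lmodType (scalarField R k)) (ip : {dot V for @sconj R k}) :=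
  forall G : set_system (normed_by ip), ProperFilter G -> cauchy G -> cvg G.

Record hilbertSpace (R : realType) (k : scalar_kind) := HilbertSpace {
  hsort :> lmodType (scalarField R k);
  inner : {dot hsort for @sconj R k};
  inner_complete : ip_complete inner }.

Definition is_adjoint (R : realType) (k : scalar_kind)
    (U W : lmodType (scalarField R k))
    (ipU : {dot U for @sconj R k}) (ipW : {dot W for @sconj R k})
    (T : U -> W) (T' : W -> U) :=
  forall u w, ipW (T u) w = ipU u (T' w).

Definition is_bounded (R : realType) (k : scalar_kind)
    (U W : lmodType (scalarField R k))
    (ipU : {dot U for @sconj R k}) (ipW : {dot W for @sconj R k})
    (T : U -> W) :=
  exists M : scalarField R k, forall u,
    `|(T u : normed_by ipW)| <= M * `|(u : normed_by ipU)|.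

Record boundedOp (R : realType) (k : scalar_kind) (U W : hilbertSpace R k) :=
  BoundedOp {
    bop :> {linear U -> W};
    bopP : is_bounded (inner U) (inner W) bop }.

Section BoundedOpZmodule.
Variables (R : realType) (k : scalar_kind) (U W : hilbertSpace R k).
Local Notation NW := (normed_by (inner W)).
Implicit Types A B C : boundedOp U W.

HB.instance Definition _ := gen_eqMixin (boundedOp U W).
HB.instance Definition _ := gen_choiceMixin (boundedOp U W).

Lemma boundedOpP A B : A =1 B -> A = B.
Proof.
case: A B => [f fc] [g gc] /= fg.
suff E : f = g by case: _ / E gc => gc; rewrite (Prop_irrelevance fc gc).
case: f g {fc gc} fg => [f [[cf] [cf']]] [g [[cg] [cg']]] /= /funext fg.
case: _ / fg cg cg' => cg cg'.
by rewrite (Prop_irrelevance cf cg) (Prop_irrelevance cf' cg').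
Qed.

Lemma bop0_bounded : is_bounded (inner U) (inner W) (\0 : U -> W).
Proof. by exists 0 => u; rewrite mul0r (normr0 NW). Qed.

Lemma bopN_bounded A : is_bounded (inner U) (inner W) (\- A).
Proof.
by have [M AM] := bopP A; exists M => u; rewrite (normrN (A u : NW)).
Qed.

Lemma bopD_bounded A B : is_bounded (inner U) (inner W) (A \+ B).
Proof.
have [M AM] := bopP A; have [N BN] := bopP B; exists (M + N) => u.
by rewrite mulrDl (le_trans (ler_normD (A u : NW) (B u : NW)))// lerD.
Qed.

Definition bop0 := BoundedOp bop0_bounded.
Definition bop_opp A := BoundedOp (bopN_bounded A).
Definition bop_add A B := BoundedOp (bopD_bounded A B).

Lemma bop_addA : associative bop_add.
Proof. by move=> A B C; apply: boundedOpP => x /=; rewrite addrA. Qed.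

Lemma bop_addC : commutative bop_add.
Proof. by move=> A B; apply: boundedOpP => x /=; rewrite addrC. Qed.

Lemma bop_add0 : left_id bop0 bop_add.
Proof. by move=> A; apply: boundedOpP => x /=; rewrite add0r. Qed.

Lemma bop_addN : left_inverse bop0 bop_opp bop_add.
Proof. by move=> A; apply: boundedOpP => x /=; rewrite addNr. Qed.

HB.instance Definition _ := GRing.isZmodule.Build (boundedOp U W)
  bop_addA bop_addC bop_add0 bop_addN.

Lemma bop0E x : (0 : boundedOp U W) x = 0. Proof. by []. Qed.

Lemma bopNE A x : (- A) x = - A x. Proof. by []. Qed.

Lemma bopDE A B x : (A + B) x = A x + B x. Proof. by []. Qed.

End BoundedOpZmodule.

Definition sections (R : realType) (k : scalar_kind) (Y : Type)
  (H : Y -> hilbertSpace R k) : Type := forall y, H y.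

Section SectionsLmodule.
Variables (R : realType) (k : scalar_kind) (Y : Type).
Variable H : Y -> hilbertSpace R k.
Local Notation F := (scalarField R k).
Implicit Types f g : sections H.

HB.instance Definition _ := gen_eqMixin (sections H).
HB.instance Definition _ := gen_choiceMixin (sections H).

Definition sec0 : sections H := fun=> 0.
Definition sec_opp f : sections H := fun y => - f y.
Definition sec_add f g : sections H := fun y => f y + g y.
Definition sec_scale (c : F) f : sections H := fun y => c *: f y.

Lemma sec_addA : associative sec_add.
Proof. by move=> f g h; apply: functional_extensionality_dep => y; exact: addrA. Qed.

Lemma sec_addC : commutative sec_add.
Proof. by move=> f g; apply: functional_extensionality_dep => y; exact: addrC. Qed.

Lemma sec_add0 : left_id sec0 sec_add.
Proof. by move=> f; apply: functional_extensionality_dep => y; exact: add0r. Qed.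

Lemma sec_addN : left_inverse sec0 sec_opp sec_add.
Proof. by move=> f; apply: functional_extensionality_dep => y; exact: addNr. Qed.

HB.instance Definition _ := GRing.isZmodule.Build (sections H)
  sec_addA sec_addC sec_add0 sec_addN.

Lemma sec_scaleA a b f : sec_scale a (sec_scale b f) = sec_scale (a * b) f.
Proof. by apply: functional_extensionality_dep => y; exact: scalerA. Qed.

Lemma sec_scale1 : left_id 1 sec_scale.
Proof. by move=> f; apply: functional_extensionality_dep => y; exact: scale1r. Qed.

Lemma sec_scaleDr : right_distributive sec_scale +%R.
Proof. by move=> a f g; apply: functional_extensionality_dep => y; exact: scalerDr. Qed.

Lemma sec_scaleDl f : {morph sec_scale^~ f : a b / a + b}.
Proof. by move=> a b; apply: functional_extensionality_dep => y; exact: scalerDl. Qed.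

HB.instance Definition _ := GRing.Zmodule_isLmodule.Build F (sections H)
  sec_scaleA sec_scale1 sec_scaleDr sec_scaleDl.

End SectionsLmodule.

Definition finitely_supported (R : realType) (k : scalar_kind) (Y : Type)
    (H : Y -> hilbertSpace R k) (f : sections H) :=
  finite_set [set y | f y <> 0].

Definition opKernel (R : realType) (k : scalar_kind) (X : Type)
  (H : X -> hilbertSpace R k) : Type := forall x y, boundedOp (H y) (H x).

Section KernelZmodule.
Variables (R : realType) (k : scalar_kind) (X : Type).
Variable H : X -> hilbertSpace R k.
Implicit Types K L : opKernel H.

HB.instance Definition _ := gen_eqMixin (opKernel H).
HB.instance Definition _ := gen_choiceMixin (opKernel H).

Definition ker0 : opKernel H := fun _ _ => 0.
Definition ker_opp K : opKernel H := fun x y => - K x y.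
Definition ker_add K L : opKernel H := fun x y => K x y + L x y.

Lemma kernelP K L : (forall x y, K x y = L x y) -> K = L.
Proof.
move=> KL; apply: functional_extensionality_dep => x.
exact: functional_extensionality_dep.
Qed.

Lemma ker_addA : associative ker_add.
Proof. by move=> K L M; apply: kernelP => x y; exact: addrA. Qed.

Lemma ker_addC : commutative ker_add.
Proof. by move=> K L; apply: kernelP => x y; exact: addrC. Qed.

Lemma ker_add0 : left_id ker0 ker_add.
Proof. by move=> K; apply: kernelP => x y; exact: add0r. Qed.

Lemma ker_addN : left_inverse ker0 ker_opp ker_add.
Proof. by move=> K; apply: kernelP => x y; exact: addNr. Qed.

HB.instance Definition _ := GRing.isZmodule.Build (opKernel H)
  ker_addA ker_addC ker_add0 ker_addN.

End KernelZmodule.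

Section Kernels.
Variables (R : realType) (k : scalar_kind) (Y : choiceType).
Variable H : Y -> hilbertSpace R k.
Local Notation F := (scalarField R k).
Implicit Types (K : opKernel H) (f g : sections H).

Definition hermitian_kernel K :=
  forall x y, is_adjoint (inner (H y)) (inner (H x)) (K x y) (K y x).

Definition psd_kernel K :=
  forall (n : nat) (x : 'I_n -> Y) (h : forall i, H (x i)),
    0 <= \sum_(i < n) \sum_(j < n)
           inner (H (x j)) (K (x j) (x i) (h i)) (h j).

(* The sums are finite, hence meaningful, for finitely supported sections. *)
Definition kernel_form K f g : F :=
  \sum_(x \in [set: Y]) \sum_(y \in [set: Y]) inner (H y) (K y x (f x)) (g y).

Definition kernel_section K (x : Y) (h : H x) : sections H :=
  fun y => K y x h.

End Kernels.

Definition block_bundle (R : realType) (k : scalar_kind) (X : choiceType)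
    (A : set X) (H : X -> hilbertSpace R k) : A -> hilbertSpace R k :=
  fun x => H (val x).

Definition block_kernel (R : realType) (k : scalar_kind) (X : choiceType)
    (A : set X) (H : X -> hilbertSpace R k) (K : opKernel H) :
    opKernel (block_bundle (A := A) H) :=
  fun x y => K (val x) (val y).

Arguments block_bundle {R k X} A H.
Arguments block_kernel {R k X} A {H} K.

Section PartialKernels.
Variables (R : realType) (k : scalar_kind) (X : choiceType) (S : Type).
Variables (Xs : S -> set X) (H : X -> hilbertSpace R k).
Implicit Types K L : opKernel H.

Definition partially_hermitian K :=
  forall s, hermitian_kernel (block_kernel (Xs s) K).

Definition partially_positive K :=
  partially_hermitian K /\ forall s, psd_kernel (block_kernel (Xs s) K).

Definition partial_le K L := partially_positive (L - K).

Definition disjoint_kernels L1 L2 :=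
  forall L, partially_positive L -> partial_le L L1 -> partial_le L L2 ->
    forall s, block_kernel (Xs s) L = 0.

End PartialKernels.

Record fundamentalSymmetry (R : realType) (k : scalar_kind)
    (V : lmodType (scalarField R k)) (b : {hermitian_sym V for @sconj R k}) :=
  FundamentalSymmetry {
    fsym :> {linear V -> V};
    fsymK : involutive fsym;
    fsym_inner : {dot V for @sconj R k};
    fsym_innerE : forall x y, fsym_inner x y = b (fsym x) y;
    fsym_complete : ip_complete fsym_inner }.

Definition krein_form (R : realType) (k : scalar_kind)
    (V : lmodType (scalarField R k)) (b : {hermitian_sym V for @sconj R k}) :=
  inhabited (fundamentalSymmetry b).

Record kreinSpace (R : realType) (k : scalar_kind) := KreinSpace {
  ksort :> lmodType (scalarField R k);
  kform : {hermitian_sym ksort for @sconj R k};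
  kformP : krein_form kform }.

Definition linear_span (F : nzRingType) (V : lmodType F) (A : set V) : set V :=
  [set u | exists (n : nat) (c : 'I_n -> F) (v : 'I_n -> V),
     (forall i, A (v i)) /\ u = \sum_(i < n) c i *: v i].

Section Linearization.
Variables (R : realType) (k : scalar_kind) (X : choiceType) (S : Type).
Variables (H : X -> hilbertSpace R k) (a : X -> S) (KK : S -> kreinSpace R k).
Variable V : forall x, {linear H x -> KK (a x)}.

(* [V x] seen as an operator into [KK s] when [a x = s]. *)
Definition op_at s x (e : a x = s) : H x -> KK s :=
  fun h => ecast t (KK t) e (V x h).

Definition bounded_bundle (J : forall s, fundamentalSymmetry (kform (KK s))) :=
  forall x, is_bounded (inner (H x)) (fsym_inner (J (a x))) (V x).

(* K(x,y) = V_x^* J_s V_y, the adjoint being taken for the inner product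
   of J_s. *)
Definition linearizes (J : forall s, fundamentalSymmetry (kform (KK s)))
    (K : opKernel H) :=
  forall s x y (ex : a x = s) (ey : a y = s),
    exists2 Vx' : KK s -> H x,
      is_adjoint (inner (H x)) (fsym_inner (J s)) (op_at ex) Vx' &
      forall h, K x y h = Vx' (J s (op_at ey h)).

Definition linearizes_form (K : opKernel H) :=
  forall s x y (ex : a x = s) (ey : a y = s) (h : H x) (l : H y),
    inner (H x) (K x y l) h = kform (KK s) (op_at ey l) (op_at ex h).

Definition ranges_at s : set (KK s) :=
  [set u | exists x (e : a x = s) (h : H x), u = op_at e h].

Definition minimal_bundle (J : forall s, fundamentalSymmetry (kform (KK s))) :=
  forall s, closure (linear_span (@ranges_at s) : set (normed_by (fsym_inner (J s))))
            = [set: normed_by (fsym_inner (J s))].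

End Linearization.

(* A linear subspace, as a vector space of its own. *)
Definition subspace_of (F : nzRingType) (V : lmodType F) (D : submodClosed V) :
  Type := {v : V | v \in D}.

HB.instance Definition _ (F : nzRingType) (V : lmodType F)
  (D : submodClosed V) := SubChoice.on (subspace_of D).
HB.instance Definition _ (F : nzRingType) (V : lmodType F)
  (D : submodClosed V) := [SubChoice_isSubLmodule of subspace_of D by <:].

Definition reproducing (R : realType) (k : scalar_kind) (Y : choiceType)
    (H : Y -> hilbertSpace R k) (K : opKernel H) (D : submodClosed (sections H))
    (b : {hermitian_sym (subspace_of D) for @sconj R k}) :=
  forall x (h : H x), exists2 Kxh : subspace_of D,
    val Kxh = kernel_section K h &
    forall f : subspace_of D, inner (H x) (val f x) h = b f Kxh.

(* Main.v *)
Require Import Defs.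
From HB Require Import structures.
From mathcomp Require Import all_boot all_order all_algebra.
From mathcomp Require Import complex ring lra.
From mathcomp Require Import all_classical all_reals all_analysis.

Set Implicit Arguments.
Unset Strict Implicit.
Unset Printing Implicit Defensive.

Import Order.TTheory GRing.Theory Num.Theory.
Import numFieldNormedType.Exports.

Local Open Scope classical_set_scope.
Local Open Scope ring_scope.

(** The block structure is inert: every assertion can be checked block by block
    and kernels given on the blocks glue together ([glue_kernels]), so the
    matter is a single positivity statement for Hermitian kernels on one set.

    The order assertions are linked by elementary moves. If [K <= L] then
    [K = L - (L - K)], and if [K = K1 - K2] then [K1 + K2] dominates [K] and
    [- K]; two-sided domination is the Cauchy-Schwarz type estimate of the
    second assertion by polarization ([form_boundP]).

    A difference [K1 - K2] is made disjoint by subtracting from both kernels a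
    maximal common minorant ([maximal_common_part]). Zorn's lemma provides it: a
    chain of positive kernels that is bounded above converges strongly, because
    a positive kernel is controlled by its diagonal ([chain_upper_bound]).

    The completion of the span of the kernel sections of a positive kernel is a
    Hilbert space of sections ([rkhs_exists]). For disjoint [K1] and [K2] the two
    spaces meet only in [0], since a common nonzero section would give a rank one
    common minorant ([bnd_disjoint]). Their direct sum, with the inner product of
    the second summand negated, is a Krein space of sections reproducing
    [K1 - K2] ([krein_of_disjoint]).

    In a reproducing kernel Krein space the operators [V_x h = K(., x) h] have
    everywhere defined adjoints for every fundamental symmetry, namely point
    evaluations up to [J], hence are bounded by the Hellinger-Toeplitz theorem
    ([hellinger_toeplitz]); the closed span is everything because a vector
    orthogonal to it vanishes at every point ([linearization_of_krein]).
    Conversely [L(x, y) = V_x^* V_y] dominates [K(x, y) = V_x^* J V_y] on both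
    sides, [J] being isometric ([linearization_bound]). *)

(** * Scalars *)

Section Scalars.
Variables (R : realType) (k : scalar_kind).
Local Notation F := (scalarField R k).
Local Notation conj := (sconj R k).
Implicit Types (z w c : F) (r s : R).

(** Estimates are carried out in [R], where the order is total: [emb] and [re]
    go back and forth, and [sq z] is [|z|^2] as a real number. *)
Definition emb : {rmorphism R -> F} :=
  match k return {rmorphism R -> scalarField R k} with
  | RealScalars => idfun
  | ComplexScalars => (real_complex R : {rmorphism R -> R[i]})
  end.

Definition re : {additive F -> R} :=
  match k return {additive scalarField R k -> R} with
  | RealScalars => idfun
  | ComplexScalars => (@complex.Re R : {additive R[i] -> R})
  end.

Definition sq z : R := re (z * conj z).

Lemma re_emb r : re (emb r) = r.
Proof. by rewrite /re /emb; case: k. Qed.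

Lemma re_embM r z : re (emb r * z) = r * re z.
Proof. by rewrite /re /emb; case: k z => //= -[a b] /=; rewrite mul0r subr0. Qed.

Lemma re_conj z : re (conj z) = re z.
Proof. by rewrite /re /sconj; case: k z => //= -[a b]. Qed.

Lemma conj_emb r : conj (emb r) = emb r.
Proof.
by rewrite /sconj /emb; case: k => //=; apply/eqP; rewrite eq_complex /= oppr0 !eqxx.
Qed.

Lemma emb_sq z : emb (sq z) = z * conj z.
Proof.
rewrite /sq /re /emb /sconj; case: k z => //= -[a b] /=.
by apply/eqP; rewrite eq_complex /= eqxx /= mulrN mulrC addNr.
Qed.

Lemma sq_ge0 z : 0 <= sq z.
Proof.
rewrite /sq /re /sconj; case: k z => [x|[a b]] /=; first by rewrite -expr2 sqr_ge0.
by rewrite mulrN opprK -!expr2 addr_ge0 ?sqr_ge0.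
Qed.

Lemma sq_eq0 z : sq z = 0 -> z = 0.
Proof.
rewrite /sq /re /sconj; case: k z => [x|[a b]] /=.
  by move/eqP; rewrite mulf_eq0 orbb => /eqP.
move/eqP; rewrite mulrN opprK -!expr2 paddr_eq0 ?sqr_ge0// !sqrf_eq0.
by move=> /andP[/eqP -> /eqP ->].
Qed.

Lemma sqM z w : sq (z * w) = sq z * sq w.
Proof. by rewrite {1}/sq rmorphM /= mulrACA -!emb_sq -rmorphM re_emb. Qed.

Lemma sq_emb r : sq (emb r) = r ^+ 2.
Proof. by rewrite /sq conj_emb -rmorphM re_emb expr2. Qed.

Lemma sq_conj z : sq (conj z) = sq z.
Proof. by rewrite /sq sconjK mulrC. Qed.

Lemma sqN z : sq (- z) = sq z.
Proof. by rewrite /sq rmorphN mulrNN. Qed.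

Lemma sq0 : sq 0 = 0.
Proof. by rewrite /sq mul0r raddf0. Qed.

Lemma re_sq_le z : re z ^+ 2 <= sq z.
Proof.
rewrite /sq /re /sconj; case: k z => [x|[a b]] /=; first by rewrite expr2.
by rewrite mulrN opprK -!expr2 lerDl sqr_ge0.
Qed.

Lemma real_scalar z : z = conj z -> z = emb (re z).
Proof.
move=> e; apply/eqP; move: e; rewrite /re /emb /sconj; case: k z => //= -[a b] [].
by move=> /eqP; rewrite -addr_eq0 -mulr2n mulrn_eq0 /= => /eqP ->.
Qed.

Lemma emb_le r s : (emb r <= emb s) = (r <= s).
Proof. by rewrite /emb; case: k => //=; exact: lecR. Qed.

Lemma ge0_emb z : 0 <= z -> z = emb (re z).
Proof.
rewrite /re /emb; case: k z => //= -[a b]; rewrite lecE /=.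
by case/andP => /eqP -> _.
Qed.

Lemma emb_ge0 r : (0 <= emb r) = (0 <= r).
Proof. by rewrite -(rmorph0 emb) emb_le. Qed.

Lemma re_ge0 z : 0 <= z -> 0 <= re z.
Proof. by move=> z0; rewrite -emb_ge0 -ge0_emb. Qed.

Lemma normsqE z : `|z| ^+ 2 = emb (sq z).
Proof. by rewrite -mul_sconj emb_sq. Qed.

Lemma sqDle z w : sq (z + w) <= 2 * sq z + 2 * sq w.
Proof.
have := sq_ge0 (z - w); rewrite /sq !rmorphD !rmorphN /= !mulrDr !mulrDl !raddfD /=.
rewrite !mulrN !mulNr !raddfN /= opprK; lra.
Qed.

(** Choose [c] along the conjugate of [z]: a real quadratic polynomial that is
    nonnegative everywhere has nonpositive discriminant. *)
Lemma discriminant (a b : R) z : 0 <= b ->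
  (forall c, 0 <= a + 2 * re (c * z) + sq c * b) -> sq z <= a * b.
Proof.
move=> b0 H; have {}H t : 0 <= a + 2 * t * sq z + t ^+ 2 * sq z * b.
  by have := H (emb t * conj z); rewrite -mulrA re_embM sqM sq_emb sq_conj
    [conj z * z]mulrC -/(sq z) mulrA.
have s0 := sq_ge0 z.
have a0 : 0 <= a by have := H 0; rewrite mulr0 !mul0r expr0n /= !mul0r !addr0.
have [bp|bn] := ltP 0 b.
  have := H (- b^-1).
  have -> : a + 2 * - b^-1 * sq z + (- b^-1) ^+ 2 * sq z * b = a - sq z * b^-1.
    by field; rewrite gt_eqF.
  by rewrite subr_ge0 ler_pdivrMr.
have bz : b = 0 by lra.
rewrite bz mulr0; apply: contrapT => /negP; rewrite -ltNge => sp.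
have := H (- (a + 1) / (2 * sq z)); rewrite bz mulr0 addr0.
have -> : a + 2 * (- (a + 1) / (2 * sq z)) * sq z = - 1.
  by field; rewrite gt_eqF.
lra.
Qed.

End Scalars.

Arguments emb {R} k.
Arguments re {R k}.

(** * Hermitian forms *)

Section Forms.
Variables (R : realType) (k : scalar_kind) (U : lmodType (scalarField R k)).
Local Notation F := (scalarField R k).
Local Notation conj := (sconj R k).
Implicit Types (A B : U -> U -> F) (x y z : U) (c : F).

(** A bare predicate on functions, shared by inner products, Krein forms and
    forms still under construction. *)
Record hform B : Prop := HForm {
  hformDl : forall x y z, B (x + y) z = B x z + B y z;
  hformZl : forall c x z, B (c *: x) z = c * B x z;
  hformC : forall x y, B x y = conj (B y x) }.

Definition qf B x : R := re (B x x).

Lemma hermitian_hform (b : {hermitian_sym U for conj}) : hform b.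
Proof.
split=> [x y z|c x z|x y]; first exact: linearDl.
  exact: linearZl_LR.
by rewrite hermC expr0 mul1r.
Qed.

Section Theory.
Variables (B : U -> U -> F) (hB : hform B).

Lemma hformDr x y z : B z (x + y) = B z x + B z y.
Proof. by rewrite (hformC hB) (hformDl hB) rmorphD /= -!(hformC hB). Qed.

Lemma hformZr c x z : B z (c *: x) = conj c * B z x.
Proof. by rewrite (hformC hB) (hformZl hB) rmorphM /= -!(hformC hB). Qed.

Lemma hformNl x z : B (- x) z = - B x z.
Proof. by rewrite -scaleN1r (hformZl hB) mulN1r. Qed.

Lemma hformNr x z : B z (- x) = - B z x.
Proof. by rewrite -scaleN1r hformZr rmorphN rmorph1 mulN1r. Qed.

Lemma hformBl x y z : B (x - y) z = B x z - B y z.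
Proof. by rewrite (hformDl hB) hformNl. Qed.

Lemma hformBr x y z : B z (x - y) = B z x - B z y.
Proof. by rewrite hformDr hformNr. Qed.

Lemma hform0l z : B 0 z = 0.
Proof. by rewrite -(scale0r 0) (hformZl hB) mul0r. Qed.

Lemma hform0r z : B z 0 = 0.
Proof. by rewrite -(scale0r 0) hformZr rmorph0 mul0r. Qed.

Lemma hform_sum I J (r : seq I) (t : seq J) (f : I -> U) (g : J -> U) :
  B (\sum_(i <- r) f i) (\sum_(j <- t) g j) = \sum_(j <- t) \sum_(i <- r) B (f i) (g j).
Proof.
have suml z : B (\sum_(i <- r) f i) z = \sum_(i <- r) B (f i) z.
  by apply: (big_morph (B^~ z)) => [x y|]; [exact: hformDl | exact: hform0l].
rewrite (big_morph (B _) (fun x y => hformDr x y _) (hform0r _)).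
by apply: eq_bigr.
Qed.

Lemma re_hformC x y : re (B x y) = re (B y x).
Proof. by rewrite (hformC hB) re_conj. Qed.

Lemma qfE x : B x x = emb k (qf B x).
Proof. by apply: real_scalar; rewrite -(hformC hB). Qed.

Lemma qf0 : qf B 0 = 0.
Proof. by rewrite /qf hform0l raddf0. Qed.

Lemma qfZ c x : qf B (c *: x) = sq c * qf B x.
Proof.
by rewrite /qf (hformZl hB) hformZr mulrA -emb_sq re_embM.
Qed.

Lemma qfN x : qf B (- x) = qf B x.
Proof. by rewrite /qf hformNl hformNr opprK. Qed.

Lemma qfBC x y : qf B (x - y) = qf B (y - x).
Proof. by rewrite -qfN opprB. Qed.

Lemma qfD x y : qf B (x + y) = qf B x + 2 * re (B x y) + qf B y.
Proof.
rewrite /qf (hformDl hB) !hformDr !raddfD /= (re_hformC y x); lra.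
Qed.

Lemma qfB x y : qf B (x - y) = qf B x - 2 * re (B x y) + qf B y.
Proof. by rewrite qfD qfN hformNr raddfN /= mulrN. Qed.

End Theory.

(** Polarization turns [|[x,x]_B| <= [x,x]_A] into the two-variable estimate;
    for [A = B] it is the Cauchy-Schwarz inequality. *)
Lemma cauchy_schwarz2 A B : hform A -> hform B ->
  (forall x, - qf A x <= qf B x) -> (forall x, qf B x <= qf A x) ->
  forall x y, sq (B x y) <= qf A x * qf A y.
Proof.
move=> hA hB AB BA x y.
have A0 z : 0 <= qf A z by have := AB z; have := BA z; lra.
apply: discriminant => // c.
have := BA (x - conj c *: y); have := AB (x + conj c *: y).
rewrite !qfB// !qfD// !qfZ// !hformZr// sconjK sq_conj => ? ?; lra.
Qed.

Section Positive.
Variables (B : U -> U -> F) (hB : hform B) (B0 : forall x, 0 <= qf B x).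

Lemma hform_cs x y : sq (B x y) <= qf B x * qf B y.
Proof.
by apply: cauchy_schwarz2 => // z; rewrite lerNl (le_trans _ (B0 z))// oppr_le0.
Qed.

Lemma re_hform_cs x y : re (B x y) ^+ 2 <= qf B x * qf B y.
Proof. exact: le_trans (re_sq_le _) (hform_cs _ _). Qed.

Lemma qfDle x y : qf B (x + y) <= 2 * qf B x + 2 * qf B y.
Proof. have := B0 (x - y); rewrite (qfB hB) (qfD hB); lra. Qed.

Lemma qf_trans x y z : qf B (x - z) <= 2 * qf B (x - y) + 2 * qf B (y - z).
Proof. by rewrite (le_trans _ (qfDle _ _))// addrA subrK. Qed.

End Positive.

Lemma dot_hform (ip : {dot U for conj}) : hform ip.
Proof. exact: hermitian_hform. Qed.

Lemma dot_qf_ge0 (ip : {dot U for conj}) x : 0 <= qf ip x.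
Proof. exact/re_ge0/ip_ge0. Qed.

Lemma dot_qf_trans (ip : {dot U for conj}) x y z :
  qf ip (x - z) <= 2 * qf ip (x - y) + 2 * qf ip (y - z).
Proof. by apply: qf_trans; [exact: dot_hform | exact: dot_qf_ge0]. Qed.

Lemma dot_qf_eq0 (ip : {dot U for conj}) x : qf ip x = 0 -> x = 0.
Proof.
by move=> q0; apply: (@ip_eq0 _ _ _ ip); rewrite (qfE (dot_hform ip)) q0 rmorph0.
Qed.

End Forms.

#[global] Hint Extern 0 (hform _) => exact: dot_hform : core.
#[global] Hint Extern 0 (hform _) => exact: hermitian_hform : core.
#[global] Hint Extern 0 (is_true (0 <= qf _ _)) => exact: dot_qf_ge0 : core.

(** * Sequential completeness *)

Section Complete.
Variables (R : realType) (k : scalar_kind) (U : lmodType (scalarField R k)).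
Local Notation F := (scalarField R k).
Local Notation conj := (sconj R k).

(** Convergence and completeness phrased with the real squared norm, so that
    no topology on [F] is involved. *)
Definition qconv (q : U -> R) (u : nat -> U) (l : U) :=
  forall e, 0 < e -> exists N, forall n, (N <= n)%N -> q (u n - l) <= e.

Definition qcauchy (q : U -> R) (u : nat -> U) :=
  forall e, 0 < e -> exists N, forall m n, (N <= m)%N -> (N <= n)%N ->
    q (u m - u n) <= e.

Definition qcomplete (q : U -> R) :=
  forall u, qcauchy q u -> exists l, qconv q u l.

Lemma inv_succ_small (e : R) : 0 < e ->
  exists N, forall n, (N <= n)%N -> n.+1%:R^-1 <= e.
Proof.
move=> e0; have [N _ HN] := near_infty_natSinv_lt (PosNum e0).
by exists N => n /HN /ltW.
Qed.

Lemma inv_succ_sqr_small (e : R) : 0 < e ->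
  exists N, forall n, (N <= n)%N -> n.+1%:R^-1 ^+ 2 <= e.
Proof.
move=> /inv_succ_small[N HN]; exists N => n /HN; apply: le_trans.
by rewrite expr2 ler_piMr ?invr_ge0// invf_le1// ler1n.
Qed.

Lemma emb_gt0 (r : R) : (0 < emb k r) = (0 < r).
Proof. by rewrite !lt_neqAle emb_ge0 eq_sym fmorph_eq0 eq_sym. Qed.

Lemma gt0_emb (c : F) : 0 < c -> exists2 r, 0 < r & c = emb k r.
Proof.
by move=> c0; have E := ge0_emb (ltW c0); exists (re c); rewrite // -emb_gt0 -E.
Qed.

Variable ip : {dot U for conj}.
Local Notation NU := (normed_by ip).

Lemma sqr_ip_normE (x : NU) : `|x| ^+ 2 = emb k (qf ip x).
Proof. by rewrite -qfE//; exact: sqr_ip_norm. Qed.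

Lemma ip_ballE (x y : NU) (e : R) : 0 <= e ->
  ball x (emb k e) y <-> qf ip (x - y) < e ^+ 2.
Proof.
move=> e0; rewrite -ball_normE /=; set z := x - y.
have z0 : 0 <= `|z : NU| by exact: normr_ge0.
rewrite -(ltr_pXn2r (isT : (0 < 2)%N)) ?nnegrE ?emb_ge0// sqr_ip_normE -rmorphXn /=.
by rewrite lt_neqAle emb_le (inj_eq (fmorph_inj _)) -lt_neqAle.
Qed.

Lemma qcomplete_ip : ip_complete ip -> qcomplete (qf ip).
Proof.
move=> ipc u uC.
have /ipc /(cvg_ex _)[l ul] : cauchy ((u : nat -> NU) @ \oo).
  apply/cauchyP => e /gt0_emb[r r0 ->].
  have [|N HN] := uC (r ^+ 2 / 2); first by rewrite divr_gt0 ?exprn_gt0.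
  exists (u N); exists N => // n /= Nn; apply/ip_ballE; first exact: ltW.
  rewrite (le_lt_trans (HN _ _ (leqnn N) Nn))// ltr_pdivrMr//.
  by rewrite ltr_pMr ?exprn_gt0// ltr1n.
exists l => e e0; have se : 0 < Num.sqrt e by rewrite sqrtr_gt0.
have : nbhs (l : NU) (ball (l : NU) (emb k (Num.sqrt e))).
  by apply: nbhsx_ballx; rewrite emb_gt0.
move=> /ul [N _ HN]; exists N => n Nn; have := HN n Nn.
move=> /(ip_ballE _ _ (ltW se)); rewrite (sqr_sqrtr (ltW e0)) => /ltW.
by rewrite qfBC.
Qed.

Lemma ip_complete_q : qcomplete (qf ip) -> ip_complete ip.
Proof.
move=> qc G GP GC.
have /choice[u Gu] : forall n, exists x : NU, G (ball x (emb k (n.+1%:R^-1))).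
  by move=> n; apply: (cauchyP _).1 GC _ _; rewrite emb_gt0 invr_gt0.
have i0 n : 0 <= n.+1%:R^-1 :> R by rewrite invr_ge0.
have d m n : qf ip (u m - u n) <= 2 * m.+1%:R^-1 ^+ 2 + 2 * n.+1%:R^-1 ^+ 2.
  have [x [/(ip_ballE _ _ (i0 _))/ltW xm /(ip_ballE _ _ (i0 _))/ltW xn]] :=
    filter_ex (filterI (Gu m) (Gu n)).
  apply: le_trans (dot_qf_trans ip _ x _) _.
  by apply: lerD; rewrite ler_pM2l// qfBC.
have [e e0|l ul] := qc u.
  have [|N HN] := @inv_succ_sqr_small (e / 4); first by rewrite divr_gt0.
  exists N => m n Nm Nn; rewrite (le_trans (d m n))//.
  move: (HN _ Nm) (HN _ Nn).
  by set x := m.+1%:R^-1 ^+ 2; set y := n.+1%:R^-1 ^+ 2; lra.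
apply/(cvg_ex _); exists (l : NU); apply/cvg_ballP => e /gt0_emb[r r0 ->].
have e2 : 0 < r ^+ 2 / 5 by rewrite divr_gt0 ?exprn_gt0.
have [N1 HN1] := ul _ e2; have [N2 HN2] := inv_succ_sqr_small e2.
pose n := maxn N1 N2.
have H1 := HN1 n (leq_maxl _ _); have H2 := HN2 n (leq_maxr _ _).
apply: filterS (Gu n) => x /(ip_ballE _ _ (i0 _))/ltW nx.
apply/ip_ballE; first exact: ltW.
apply: le_lt_trans (dot_qf_trans ip _ (u n) _) _.
rewrite (qfBC _ l)//; move: nx H1 H2; set y := n.+1%:R^-1 ^+ 2; lra.
Qed.

End Complete.

(** * Riesz representation, density, and automatic boundedness *)

Lemma le0_of_small (R : realType) (x C : R) : 0 <= C ->
  (forall e, 0 < e -> x <= e * C) -> x <= 0.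
Proof.
move=> C0 H; apply: contrapT => /negP; rewrite -ltNge => x0.
have := H (x / (2 * (C + 1))); have p : 0 < 2 * (C + 1) by lra.
rewrite divr_gt0// => /(_ isT).
rewrite mulrAC ler_pdivlMr// ler_pM2l//; lra.
Qed.

Section Hilbert.
Variables (R : realType) (k : scalar_kind) (U : lmodType (scalarField R k)).
Local Notation F := (scalarField R k).
Local Notation conj := (sconj R k).
Variable B : U -> U -> F.
Hypotheses (hB : hform B) (B0 : forall x, 0 <= qf B x) (Bc : qcomplete (qf B)).

(** The vector representing [phi] is the limit of a minimizing sequence of
    [q m - 2 re (phi m)]: the parallelogram law makes that sequence Cauchy, and
    the first variation at the minimum is [B v m = phi m]. *)
Lemma minimize (M : set U) (phi : U -> F) (C : R) : 0 <= C -> M 0 ->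
  (forall x y, M x -> M y -> M (x + y)) -> (forall c x, M x -> M (c *: x)) ->
  (forall x y, M x -> M y -> phi (x + y) = phi x + phi y) ->
  (forall c x, M x -> phi (c *: x) = conj c * phi x) ->
  (forall x, M x -> sq (phi x) <= C * qf B x) ->
  exists2 v, (forall e, 0 < e -> exists2 m, M m & qf B (v - m) <= e) &
    forall m, M m -> B v m = phi m.
Proof.
move=> C0 M0 MD MZ phiD phiZ phiC.
pose Q x := qf B x - 2 * re (phi x).
have Qlb x : M x -> - C <= Q x.
  move=> Mx; have h := le_trans (re_sq_le _) (phiC _ Mx); have x0 := B0 x.
  rewrite /Q; move: (qf B x) (re (phi x)) h x0 => a p h a0.
  suff : 2 * p <= a + C by lra.
  rewrite leNgt; apply/negP => lt.
  have : (a + C) ^+ 2 < (2 * p) ^+ 2 by rewrite ltr_pXn2r// nnegrE; lra.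
  have := sqr_ge0 (a - C); nra.
pose D := [set Q x | x in M].
have Dinf : has_inf D by split; [exists (Q 0), 0 | exists (- C) => _ [x Mx <-]; exact: Qlb].
have Dle x : M x -> inf D <= Q x by move=> Mx; apply: ge_inf; [exact: Dinf.2 | exists x].
have /choice[u uP] : forall n : nat, exists x, M x /\ Q x <= inf D + n.+1%:R^-1.
  move=> n; have i0 : 0 < n.+1%:R^-1 :> R by rewrite invr_gt0.
  by have [_ [y My <-] /ltW] := inf_adherent i0 Dinf; exists y.
have par x y : M x -> M y -> qf B (x - y) <= 2 * (Q x - inf D) + 2 * (Q y - inf D).
  move=> Mx My; have := Dle _ (MZ (emb k (2^-1)) _ (MD _ _ Mx My)).
  rewrite /Q phiZ; last exact: MD.
  rewrite qfZ// sq_emb conj_emb re_embM phiD// raddfD /= qfD// qfB//.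
  set a := qf B x; set b := qf B y; lra.
have [e e0|v uv] := Bc (u := u).
  have [|N HN] := @inv_succ_small R (e / 4); first by rewrite divr_gt0.
  exists N => m n /HN Nm /HN Nn.
  apply: le_trans (par _ _ (uP m).1 (uP n).1) _.
  have := (uP m).2; have := (uP n).2; move: Nm Nn.
  set x := m.+1%:R^-1; set y := n.+1%:R^-1; lra.
exists v => [e e0|m Mm].
  have [N HN] := uv e e0; exists (u N); first exact: (uP N).1.
  by rewrite qfBC// HN.
have var n : sq (B (u n) m - phi m) <= (Q (u n) - inf D) * qf B m.
  apply: discriminant => // c.
  have := Dle _ (MD _ _ (uP n).1 (MZ (conj c) _ Mm)).
  rewrite /Q phiD ?phiZ//; [|exact: (uP n).1|exact: MZ].
  rewrite qfD// qfZ// sq_conj hformZr// sconjK mulrBr !raddfB raddfD /=.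
  lra.
apply/eqP; rewrite -subr_eq0; apply/eqP/sq_eq0/eqP; rewrite eq_le sq_ge0 andbT.
apply: (@le0_of_small _ _ (4 * qf B m)) => [|e e0]; first by rewrite mulr_ge0.
have [N1 HN1] := uv e e0; have [N2 HN2] := @inv_succ_small R e e0.
pose n := maxn N1 N2.
have H1 := HN1 n (leq_maxl _ _); have H2 := HN2 n (leq_maxr _ _).
have -> : B v m - phi m = B (v - u n) m + (B (u n) m - phi m).
  by rewrite hformBl// addrA subrK.
apply: le_trans (sqDle _ _) _.
have -> : e * (4 * qf B m) = 2 * (e * qf B m) + 2 * (e * qf B m) by ring.
apply: lerD; rewrite ler_pM2l//.
  by apply: le_trans (hform_cs hB B0 _ _) _; rewrite ler_wpM2r// qfBC.
apply: le_trans (var n) _; rewrite ler_wpM2r// lerBlDl.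
by apply: le_trans (uP n).2 _; rewrite lerD2l.
Qed.

Lemma riesz (phi : U -> F) (C : R) : 0 <= C ->
  (forall x y, phi (x + y) = phi x + phi y) ->
  (forall c x, phi (c *: x) = conj c * phi x) ->
  (forall x, sq (phi x) <= C * qf B x) ->
  exists v, forall u, B v u = phi u.
Proof.
move=> C0 phiD phiZ phiC.
have [|||||||v _ vP] := @minimize setT phi C => //; exists v => u; exact: vP.
Qed.

(** The vector of the closure of [M] that represents [B x] on [M] differs from
    [x] by a vector orthogonal to [M]. *)
Lemma dense_subspace (M : set U) : M 0 ->
  (forall x y, M x -> M y -> M (x + y)) -> (forall c x, M x -> M (c *: x)) ->
  (forall v, (forall m, M m -> B v m = 0) -> v = 0) ->
  forall x e, 0 < e -> exists2 m, M m & qf B (x - m) <= e.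
Proof.
move=> M0 MD MZ Mperp x.
have [|||v vM vP] := @minimize M (B x) (qf B x) (B0 x) M0 MD MZ.
- by move=> y z _ _; exact: hformDr.
- by move=> c y _; exact: hformZr.
- by move=> y _; exact: hform_cs.
suff -> : x = v by [].
apply/esym/eqP; rewrite -subr_eq0; apply/eqP/Mperp => m Mm.
by rewrite hformBl// vP// subrr.
Qed.

End Hilbert.

Section HellingerToeplitz.
Variables (R : realType) (k : scalar_kind) (U W : lmodType (scalarField R k)).
Local Notation F := (scalarField R k).
Local Notation conj := (sconj R k).
Variables (A : U -> U -> F) (B : W -> W -> F).
Hypotheses (hA : hform A) (A0 : forall x, 0 <= qf A x).
Hypotheses (hB : hform B) (B0 : forall x, 0 <= qf B x) (Bc : qcomplete (qf B)).

(** Hellinger-Toeplitz, by a gliding hump: if the bound failed along [u n],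
    steps of size about [10^-n] in the direction [T (u n)], with well chosen
    signs, would converge to some [w] on which the functionals
    [B ^~ (T (u n)) = A (T' _) (u n)] exceed [|T' w| |u n|]. *)
Lemma hellinger_toeplitz (T : U -> W) (T' : W -> U) :
  (forall u w, B (T u) w = A u (T' w)) ->
  exists2 C, 0 <= C & forall u, qf B (T u) <= C * qf A u.
Proof.
move=> adj; apply: contrapT => H.
have /choice[u uP] : forall n, exists u, 100 ^+ n * n.+1%:R * qf A u < qf B (T u).
  move=> n; apply: contrapT => H'; apply: H.
  exists (100 ^+ n * n.+1%:R); first by rewrite mulr_ge0// exprn_ge0.
  by move=> u; rewrite leNgt; apply/negP => ?; apply: H'; exists u.
(* The ratio 100 leaves room for the factors 2 lost in each use of
   [|x + y|^2 <= 2 |x|^2 + 2 |y|^2]. *)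
pose r n : R := (100 ^+ n)^-1.
have r0 n : 0 < r n by rewrite invr_gt0 exprn_gt0.
have rS n : r n.+1 = r n / 100 by rewrite /r exprS invfM mulrC.
have Q0 n : 0 < qf B (T (u n)).
  by apply: le_lt_trans (uP n); rewrite mulr_ge0// mulr_ge0// exprn_ge0.
pose s n := emb k (Num.sqrt (r n / qf B (T (u n)))) *: T (u n).
have sE n : sq (emb k (Num.sqrt (r n / qf B (T (u n))))) = r n / qf B (T (u n)).
  by rewrite sq_emb sqr_sqrtr// divr_ge0// ltW.
have qs n : qf B (s n) = r n by rewrite qfZ// sE divfK// gt_eqF.
have phis n : sq (B (s n) (T (u n))) = r n * qf B (T (u n)).
  by rewrite (hformZl hB) sqM sE (qfE hB) sq_emb expr2 mulrA divfK// gt_eqF.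
(* One of the two signs does not decrease the value at [T (u n)] below that of
   the step alone. *)
pose step n w := if sq (B (w + s n) (T (u n))) >= r n * qf B (T (u n))
  then w + s n else w - s n.
pose w := fix w n := if n is m.+1 then step m (w m) else 0.
have hump n : r n * qf B (T (u n)) <= sq (B (w n.+1) (T (u n))).
  rewrite /= /step; case: ifP => // /negbT; rewrite -ltNge => lt.
  rewrite -phis in lt *.
  have := sq_ge0 (B (w n) (T (u n))); move: lt.
  rewrite !hformBl// !(hformDl hB); move: (B (w n) _) (B (s n) _) => x y.
  rewrite /sq !rmorphD !rmorphN !mulrDr !mulrDl !raddfD /= !(mulNr, mulrN) !raddfN /= opprK.
  lra.
have stepE n : qf B (w n.+1 - w n) = r n.
  by rewrite /= /step; case: ifP => _; rewrite addrC addKr ?qfN// qs.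
have dist j : forall n, qf B (w (n + j)%N - w n) <= 3 * r n.
  elim: j => [n|j IH n]; first by rewrite addn0 subrr qf0// mulr_ge0// ltW.
  apply: le_trans (qf_trans hB B0 _ (w n.+1) _) _.
  have := IH n.+1; rewrite addSnnS stepE rS; have := r0 n; lra.
have dist' n m : (n <= m)%N -> qf B (w m - w n) <= 3 * r n.
  by move=> nm; rewrite -(subnKC nm).
have small e : 0 < e -> exists N, forall n, (N <= n)%N -> r n <= e.
  move=> e0; have [N HN] := inv_succ_small e0; exists N => n /HN; apply: le_trans.
  rewrite lef_pV2 ?posrE ?exprn_gt0// -natrX ler_nat.
  by apply: ltn_expl.
have [e e0|l wl] := Bc (u := w).
  have [|N HN] := small (e / 12); first by rewrite divr_gt0.
  exists N => m n Nm Nn.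
  apply: le_trans (qf_trans hB B0 _ (w N) _) _.
  rewrite (qfBC hB (w N)); have := dist' _ _ Nm; have := dist' _ _ Nn.
  have := HN N (leqnn N); lra.
have far n : 4 / 10 * (r n * qf B (T (u n))) <= sq (B l (T (u n))).
  have [|N HN] := wl (r n / 100); first by rewrite divr_gt0.
  have d : qf B (w n.+1 - l) <= r n / 10.
    have := dist' _ _ (leq_maxr N n.+1); have := HN _ (leq_maxl N n.+1).
    have := qf_trans hB B0 (w n.+1) (w (maxn N n.+1)) l.
    rewrite (qfBC hB (w n.+1) (w (maxn _ _))) rS; have := r0 n; lra.
  have := hump n; rewrite -[w n.+1](subrK l) (hformDl hB) => h.
  have := le_trans h (sqDle _ _).
  have := le_trans (hform_cs hB B0 _ _) (ler_wpM2r (B0 (T (u n))) d).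
  lra.
pose n := Num.truncn (qf A (T' l) * 10).
have Hn : qf A (T' l) * 10 < n.+1%:R.
  by case/andP: (truncn_itv (mulr_ge0 (A0 (T' l)) (ler0n _ 10))).
have up : sq (B l (T (u n))) <= qf A (T' l) * qf A (u n).
  by rewrite (hformC hB) sq_conj adj (hformC hA) sq_conj; exact: hform_cs.
have lo : n.+1%:R * qf A (u n) < r n * qf B (T (u n)).
  by rewrite [ltRHS]mulrC ltr_pdivlMr ?exprn_gt0// mulrC mulrA.
have := far n; have := A0 (u n); have := mulr_gt0 (r0 n) (Q0 n); move: up lo Hn.
move: (qf A (T' l)) (qf A (u n)) n.+1%:R (r n * _) (sq _) => a b m d c.
nra.
Qed.

End HellingerToeplitz.

Section BoundedOperators.
Variables (R : realType) (k : scalar_kind).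
Local Notation F := (scalarField R k).
Local Notation conj := (sconj R k).

Lemma is_boundedP (U W : lmodType F) (ipU : {dot U for conj})
    (ipW : {dot W for conj}) (T : U -> W) :
  is_bounded ipU ipW T <->
  exists2 C, 0 <= C & forall u, qf ipW (T u) <= C * qf ipU u.
Proof.
split=> [[M HM]|[C C0 HC]].
  exists (sq M) => [|u]; first exact: sq_ge0.
  have := HM u; rewrite -(@emb_le R k) rmorphM /= -!sqr_ip_normE -normsqE -exprMn.
  set t := `|_|; set v := `|(u : normed_by ipU)| => le.
  have t0 : 0 <= t by exact: normr_ge0.
  have v0 : 0 <= v by exact: normr_ge0.
  rewrite ler_pXn2r ?nnegrE ?mulr_ge0//.
  by rewrite -[v in `|M| * v](ger0_norm v0) -normrM (ger0_norm (le_trans t0 le)).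
exists (emb k (Num.sqrt C)) => u.
rewrite -(ler_pXn2r (isT : (0 < 2)%N)) ?nnegrE ?mulr_ge0 ?normr_ge0 ?emb_ge0//.
by rewrite exprMn !sqr_ip_normE -rmorphXn -rmorphM /= emb_le sqr_sqrtr.
Qed.

Lemma inner_qcomplete (U : hilbertSpace R k) : qcomplete (qf (inner U)).
Proof. by apply: qcomplete_ip; exact: inner_complete. Qed.

(** Everywhere defined adjoints make an operator both linear and bounded, so
    kernels are given below by mere functions with adjoints. *)
Lemma adjoint_boundedOp (U W : hilbertSpace R k) (T : U -> W) (T' : W -> U) :
  is_adjoint (inner U) (inner W) T T' -> exists A : boundedOp U W, A =1 T.
Proof.
move=> adj.
have sep (x y : W) : (forall w, inner W x w = inner W y w) -> x = y.
  move=> e; apply/eqP; rewrite -subr_eq0; apply/eqP/(@ip_eq0 _ _ _ (inner W)).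
  by rewrite linearBl /= e subrr.
have lT : linear T.
  move=> c x y; apply: sep => w.
  have hU := dot_hform (inner U); have hW := dot_hform (inner W).
  by rewrite adj (hformDl hU) (hformZl hU) (hformDl hW) (hformZl hW) !adj.
pose T1 : {linear U -> W} := HB.pack T (GRing.isLinear.Build _ _ _ _ _ lT).
have bT : is_bounded (inner U) (inner W) T1.
  apply/is_boundedP; apply: (hellinger_toeplitz _ _ _ _ _ adj) => //.
  exact: inner_qcomplete.
by exists (BoundedOp bT).
Qed.

(** Riesz is applied to the antilinear functionals [u |-> <w, T u>]. *)
Lemma adjoint_exists (U : hilbertSpace R k) (W : lmodType F)
    (ipW : {dot W for conj}) (T : {linear U -> W}) :
  is_bounded (inner U) ipW T -> exists T', is_adjoint (inner U) ipW T T'.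
Proof.
move=> /is_boundedP[C C0 TC].
suff /choice[T' T'P] : forall w, exists v, forall u, ipW (T u) w = inner U u v.
  by exists T' => u w; exact: T'P.
move=> w; have [||||||v vP] := @riesz _ _ _ (inner U) _ _ (@inner_qcomplete U)
  (fun u => ipW w (T u)) (C * qf ipW w).
- by [].
- by [].
- by rewrite mulr_ge0.
- by move=> x y; rewrite linearD linearDr.
- by move=> c x; rewrite linearZ hformZr.
- move=> x; apply: le_trans (hform_cs _ _ _ _) _ => //.
  by rewrite mulrC mulrAC ler_wpM2r.
by exists v => u; rewrite ipC -vP -ipC.
Qed.

End BoundedOperators.

(** * Operator valued kernels *)

Section KernelTheory.
Variables (R : realType) (k : scalar_kind) (Y : choiceType).
Variable H : Y -> hilbertSpace R k.
Local Notation F := (scalarField R k).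
Local Notation conj := (sconj R k).
Local Notation ip y := (inner (H y)).
Implicit Types (K L : opKernel H) (f g : sections H).

(** Formal finite sums of the [K(., y) h]. Repetitions are allowed, so
    concatenation and scaling act as vector space operations. *)
Definition combo := seq {y : Y & H y}.
Implicit Types u v w : combo.

Definition scale_combo (c : F) u : combo :=
  [seq existT (fun y => H y : Type) (tag p) (c *: tagged p) | p <- u].

Definition pairing f u : F := \sum_(p <- u) ip (tag p) (f (tag p)) (tagged p).

Definition combo_section K u : sections H :=
  fun y => \sum_(p <- u) K y (tag p) (tagged p).

(** The form [[w, u]_K] of the kernel, read on combos. *)
Definition gram K w u : F := pairing (combo_section K w) u.

Definition gramq K u : R := re (gram K u u).

Lemma pairing_cat f u v : pairing f (u ++ v) = pairing f u + pairing f v.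
Proof. by rewrite /pairing big_cat. Qed.

Lemma pairing_scale c f u : pairing f (scale_combo c u) = conj c * pairing f u.
Proof.
rewrite /pairing big_map mulr_sumr; apply: eq_bigr => p _ /=.
exact: linearZr_LR.
Qed.

Lemma pairingD f g u : pairing (f + g) u = pairing f u + pairing g u.
Proof. by rewrite /pairing -big_split; apply: eq_bigr => p _; exact: linearDl. Qed.

Lemma pairingZ c f u : pairing (c *: f) u = c * pairing f u.
Proof. by rewrite /pairing mulr_sumr; apply: eq_bigr => p _; exact: linearZl_LR. Qed.

Lemma pairingN f u : pairing (- f) u = - pairing f u.
Proof. by rewrite -scaleN1r pairingZ mulN1r. Qed.

Lemma pairingB f g u : pairing (f - g) u = pairing f u - pairing g u.
Proof. by rewrite pairingD pairingN. Qed.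

Lemma pairing0 u : pairing 0 u = 0.
Proof. by rewrite -(scale0r 0) pairingZ mul0r. Qed.

Lemma pairing1 f y (h : H y) : pairing f [:: existT _ y h] = ip y (f y) h.
Proof. by rewrite /pairing big_seq1. Qed.

Lemma combo_section_cat K u v :
  combo_section K (u ++ v) = combo_section K u + combo_section K v.
Proof. by apply: functional_extensionality_dep => y; rewrite /combo_section big_cat. Qed.

Lemma combo_section_scale K c u :
  combo_section K (scale_combo c u) = c *: combo_section K u.
Proof.
apply: functional_extensionality_dep => y; rewrite /combo_section big_map.
rewrite [RHS](scaler_sumr c u xpredT (fun p => K y (tag p) (tagged p))).
by apply: eq_bigr => p _ /=; rewrite linearZ.
Qed.

Lemma combo_section1 K y (h : H y) : combo_section K [:: existT _ y h] = kernel_section K h.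
Proof.
by apply: functional_extensionality_dep => z; rewrite /combo_section big_seq1.
Qed.

Lemma gramE K w u : gram K w u =
  \sum_(q <- u) \sum_(p <- w) ip (tag q) (K (tag q) (tag p) (tagged p)) (tagged q).
Proof. by apply: eq_bigr => q _; rewrite linear_sumlz. Qed.

Lemma kernelDE K L x y h : (K + L) x y h = K x y h + L x y h. Proof. by []. Qed.

Lemma kernelNE K x y h : (- K) x y h = - K x y h. Proof. by []. Qed.

Lemma gramD K L w u : gram (K + L) w u = gram K w u + gram L w u.
Proof.
rewrite !gramE -big_split; apply: eq_bigr => q _; rewrite -big_split.
by apply: eq_bigr => p _; rewrite kernelDE linearDl.
Qed.

Lemma gramN K w u : gram (- K) w u = - gram K w u.
Proof.
rewrite !gramE -sumrN; apply: eq_bigr => q _; rewrite -sumrN.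
by apply: eq_bigr => p _; rewrite kernelNE linearNl.
Qed.

Lemma gram0 w u : gram (0 : opKernel H) w u = 0.
Proof.
rewrite !gramE big1// => q _; rewrite big1// => p _.
by rewrite bop0E linear0l.
Qed.

Lemma gramqD K L u : gramq (K + L) u = gramq K u + gramq L u.
Proof. by rewrite /gramq gramD raddfD. Qed.

Lemma gramqN K u : gramq (- K) u = - gramq K u.
Proof. by rewrite /gramq gramN raddfN. Qed.

Lemma gramqB K L u : gramq (K - L) u = gramq K u - gramq L u.
Proof. by rewrite gramqD gramqN. Qed.

Lemma gramq1 K y (h : H y) : gramq K [:: existT _ y h] = re (ip y (K y y h) h).
Proof. by rewrite /gramq gramE !big_seq1. Qed.

Lemma hermitianD K L : hermitian_kernel K -> hermitian_kernel L ->
  hermitian_kernel (K + L).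
Proof. by move=> hK hL x y h l; rewrite !kernelDE (hformDl (dot_hform _)) hformDr// hK hL. Qed.

Lemma hermitianN K : hermitian_kernel K -> hermitian_kernel (- K).
Proof. by move=> hK x y h l; rewrite !kernelNE hformNl// hformNr// hK. Qed.

Lemma hermitianB K L : hermitian_kernel K -> hermitian_kernel L ->
  hermitian_kernel (K - L).
Proof. by move=> hK hL; apply: hermitianD => //; exact: hermitianN. Qed.

Lemma hermitian0 : hermitian_kernel (0 : opKernel H).
Proof. by move=> x y h l; rewrite hform0l// hform0r. Qed.

Lemma gramC K w u : hermitian_kernel K -> gram K w u = conj (gram K u w).
Proof.
move=> hK; rewrite !gramE rmorph_sum /= exchange_big /=; apply: eq_bigr => p _.
rewrite rmorph_sum; apply: eq_bigr => q _.
by rewrite hK ipC.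
Qed.

Lemma gramqE K u : hermitian_kernel K -> gram K u u = emb k (gramq K u).
Proof. by move=> hK; apply/real_scalar/gramC. Qed.

Lemma psd_gramP K : hermitian_kernel K ->
  psd_kernel K <-> forall u, 0 <= gramq K u.
Proof.
move=> hK; split=> [pK u|pK n x h].
  rewrite -(@emb_ge0 _ k) -gramqE// gramE.
  have := pK (size u) (fun i => tag (tnth (in_tuple u) i))
    (fun i => tagged (tnth (in_tuple u) i)).
  rewrite exchange_big /=; congr (0 <= _).
  rewrite [RHS](big_tnth _ _ u); apply: eq_bigr => j _.
  by rewrite [RHS](big_tnth _ _ u).
pose u : combo := [seq existT (fun y => H y : Type) (x i) (h i) | i <- index_enum 'I_n].
have := pK u; rewrite -(@emb_ge0 _ k) -gramqE// gramE /u big_map exchange_big /=.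
by congr (0 <= _); rewrite big_map; apply: eq_bigr.
Qed.

Lemma gramq_cat K u v : hermitian_kernel K ->
  gramq K (u ++ v) = gramq K u + 2 * re (gram K u v) + gramq K v.
Proof.
move=> hK; rewrite /gramq /gram combo_section_cat !pairing_cat !pairingD.
rewrite -!/(gram _ _ _) (gramC v u hK) !raddfD /= re_conj; lra.
Qed.

Lemma gramq_scale K c u : hermitian_kernel K ->
  gramq K (scale_combo c u) = sq c * gramq K u.
Proof.
move=> hK; rewrite /gramq /gram combo_section_scale pairingZ pairing_scale.
by rewrite mulrA -emb_sq re_embM.
Qed.

(** The same polarization argument as in [cauchy_schwarz2], combos being closed
    under concatenation and scaling. *)
Lemma gram_cs2 K L w u : hermitian_kernel K -> hermitian_kernel L ->
  (forall v, - gramq L v <= gramq K v) -> (forall v, gramq K v <= gramq L v) ->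
  sq (gram K w u) <= gramq L w * gramq L u.
Proof.
move=> hK hL KL LK.
have L0 v : 0 <= gramq L v by have := KL v; have := LK v; lra.
apply: discriminant => // c.
have := KL (w ++ scale_combo (conj c) u); have := LK (w ++ scale_combo (- conj c) u).
rewrite !gramq_cat// !gramq_scale// !sqN !sq_conj /gram !pairing_scale !rmorphN.
rewrite /= !sconjK !mulNr !raddfN /=; lra.
Qed.

Lemma gram_cs K w u : hermitian_kernel K -> (forall u, 0 <= gramq K u) ->
  sq (gram K w u) <= gramq K w * gramq K u.
Proof.
move=> hK pK; apply: gram_cs2 => // v.
by rewrite lerNl (le_trans _ (pK v))// oppr_le0.
Qed.

Lemma diag_bounded K x : exists2 C, 0 <= C &
  forall h : H x, re (ip x (K x x h) h) <= C * qf (ip x) h.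
Proof.
have [C C0 KC] := (is_boundedP (ip x) (ip x) (K x x)).1 (bopP (K x x)).
exists (C + 1) => [|h]; first by rewrite addr_ge0.
have := re_hform_cs (dot_hform (ip x)) (dot_qf_ge0 (ip x)) (K x x h) h.
have := KC h; have := dot_qf_ge0 (ip x) (K x x h); have := dot_qf_ge0 (ip x) h.
set a := qf _ h; set b := qf _ (K x x h); set c := re _ => a0 b0 bC cs.
have : c ^+ 2 <= ((C + 1) * a) ^+ 2.
  apply: le_trans cs _; apply: le_trans (ler_wpM2r a0 bC) _.
  rewrite -mulrA -expr2 exprMn ler_wpM2r ?sqr_ge0//; nra.
rewrite leNgt => nlt; rewrite leNgt; apply: contra nlt => lt.
by rewrite ltr_pXn2r// nnegrE ?mulr_ge0// ?addr_ge0// (le_trans _ (ltW lt))// mulr_ge0// addr_ge0.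
Qed.

(** A positive kernel is controlled by its diagonal in the strong sense: apply
    Cauchy-Schwarz to [K x y h] against [h]. *)
Lemma entry_le_diag K x y C : hermitian_kernel K -> (forall u, 0 <= gramq K u) ->
  0 <= C -> (forall h : H x, re (ip x (K x x h) h) <= C * qf (ip x) h) ->
  forall h : H y, qf (ip x) (K x y h) <= C * re (ip y (K y y h) h).
Proof.
move=> hK pK C0 KC h; set g := K x y h.
have := gram_cs [:: existT _ y h] [:: existT _ x g] hK pK.
rewrite !gramq1 /gram combo_section1 pairing1 /kernel_section -/g.
have d0 := pK [:: existT _ y h]; rewrite gramq1 in d0.
have g0 := dot_qf_ge0 (ip x) g.
rewrite (qfE (dot_hform (ip x))) sq_emb => cs.
have {}cs : qf (ip x) g ^+ 2 <= re (ip y (K y y h) h) * (C * qf (ip x) g).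
  by apply: le_trans cs _; rewrite ler_wpM2l.
have [->|gp] := eqVneq (qf (ip x) g) 0; first exact: mulr_ge0.
have {}gp : 0 < qf (ip x) g by rewrite lt_neqAle eq_sym gp.
by rewrite -(ler_pM2r gp) -expr2 mulrAC mulrC.
Qed.

Lemma kernel_of_adjoints (M : forall x y, H y -> H x) :
  (forall x y, is_adjoint (ip y) (ip x) (M x y) (M y x)) ->
  exists K, forall x y h, K x y h = M x y h.
Proof.
move=> adj.
by exists (fun x y => projT1 (cid (adjoint_boundedOp (adj x y)))) => x y h; case: cid.
Qed.

Lemma psd_le0 K : hermitian_kernel K -> (forall u, gramq K u = 0) -> K = 0.
Proof.
move=> hK K0; apply: kernelP => x y; apply: boundedOpP => h.
apply: (@dot_qf_eq0 _ _ _ (ip x)).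
have := gram_cs [:: existT _ y h] [:: existT _ x (K x y h)] hK.
rewrite !K0 mul0r /gram combo_section1 pairing1 => le.
rewrite /qf; have /sq_eq0 -> : sq (ip x (K x y h) (K x y h)) = 0; last exact: raddf0.
by apply/eqP; rewrite eq_le sq_ge0 le// => u; rewrite K0.
Qed.

End KernelTheory.

(** * Removing the common part of two positive kernels *)

Section Maximal.
Variables (R : realType) (k : scalar_kind) (Y : choiceType).
Variable H : Y -> hilbertSpace R k.
Local Notation F := (scalarField R k).
Local Notation ip y := (inner (H y)).
Implicit Types (K L M V : opKernel H).

Definition positive K := hermitian_kernel K /\ forall u, 0 <= gramq K u.

Lemma positive0 : positive (0 : opKernel H).
Proof. by split=> [|u]; [exact: hermitian0 | rewrite /gramq gram0 raddf0]. Qed.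

Lemma positiveD K L : positive K -> positive L -> positive (K + L).
Proof.
move=> [hK pK] [hL pL]; split; first exact: hermitianD.
by move=> u; rewrite gramqD addr_ge0.
Qed.

Lemma positive_trans K L M : positive (L - K) -> positive (M - L) -> positive (M - K).
Proof. by move=> /positiveD/[apply]; rewrite addrC addrA subrK. Qed.

Section Chain.
Variables (K : opKernel H) (A : set (opKernel H)).
Hypotheses (A_pos : forall M, A M -> positive M).
Hypotheses (A_le : forall M, A M -> positive (K - M)).
Hypotheses (A_total : forall M N, A M -> A N -> positive (N - M) \/ positive (M - N)).
Hypotheses (A_ne : A !=set0).

(* [P] holds eventually along the chain. *)
Let ev (P : opKernel H -> Prop) :=
  exists2 M0, A M0 & forall M, A M -> positive (M - M0) -> P M.

Let evI P Q : ev P -> ev Q -> ev (fun M => P M /\ Q M).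
Proof.
move=> [M AM MP] [N AN NQ]; have [MN|NM] := A_total AM AN.
  by exists N => // M' AM' le; split; [apply: MP => //; exact: positive_trans le | exact: NQ].
by exists M => // M' AM' le; split; [exact: MP | apply: NQ => //; exact: positive_trans le].
Qed.

Let evW P Q : (forall M, A M -> P M -> Q M) -> ev P -> ev Q.
Proof. by move=> PQ [M AM MP]; exists M => // M' AM' le; apply: PQ => //; exact: MP. Qed.

Let ev_ex P : ev P -> exists2 M, A M & P M.
Proof. by move=> [M AM MP]; exists M => //; apply: MP => //; rewrite subrr; exact: positive0. Qed.

Let ev_ge M0 : A M0 -> ev (fun M => positive (M - M0)).
Proof. by move=> AM; exists M0. Qed.

(** The diagonal values [<M y y h, h>] increase along the chain and are bounded
    by those of [K]; [entry_le_diag] upgrades their convergence to norm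
    convergence of every [M x y h]. *)
Let entry_limit x y (h : H y) : exists v : H x,
  forall e, 0 < e -> ev (fun M => qf (ip x) (v - M x y h) <= e).
Proof.
have [C C0 KC] := diag_bounded K x.
pose d M := re (ip y (M y y h) h).
have dE M : d M = gramq M [:: existT _ y h] by rewrite gramq1.
pose D := [set d M | M in A].
have Dsup : has_sup D.
  split; first by have [M AM] := A_ne; exists (d M), M.
  exists (d K) => _ [M AM <-]; rewrite -subr_ge0 !dE -gramqB.
  exact: (A_le AM).2.
have cauchy_e e : 0 < e -> exists2 M0, A M0 &
    forall M, A M -> positive (M - M0) -> qf (ip x) (M x y h - M0 x y h) <= e.
  move=> e0; have C1 : 0 < C + 1 by rewrite ltr_wpDl.
  have [_ [M0 AM0 <-] lt] := sup_adherent (divr_gt0 e0 C1) Dsup.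
  exists M0 => // M AM [hM pM].
  have -> : M x y h - M0 x y h = (M - M0) x y h by [].
  apply: le_trans (entry_le_diag hM pM C0 _ h) _.
    move=> l; apply: le_trans (KC l); rewrite -!gramq1 -subr_ge0 -gramqB.
    have -> : K - (M - M0) = (K - M) + M0 by rewrite opprB addrCA addrC.
    by apply: (positiveD (A_le AM) (A_pos AM0)).2.
  have -> : re (ip y ((M - M0) y y h) h) = d M - d M0 by rewrite !dE -gramqB gramq1.
  have : d M - d M0 <= e / (C + 1).
    have : d M <= sup D by apply: sup_upper_bound => //; exists M.
    by move: lt; lra.
  rewrite ler_pdivlMr// => le; apply: le_trans le.
  have : 0 <= d M - d M0 by rewrite !dE -gramqB; exact: pM.
  move: (d M - d M0) => z; nra.
have /choice[M MP] : forall n : nat, exists M0, A M0 /\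
    forall M, A M -> positive (M - M0) -> qf (ip x) (M x y h - M0 x y h) <= n.+1%:R^-1.
  move=> n; have [|M0 AM0 H0] := cauchy_e n.+1%:R^-1; first by rewrite invr_gt0.
  by exists M0.
have [e e0|v vP] := @inner_qcomplete _ _ (H x) (fun n => M n x y h).
  have [|N HN] := @inv_succ_small R (e / 4); first by rewrite divr_gt0.
  exists N => m n /HN Nm /HN Nn.
  have [M' AM' [mM nM]] := ev_ex (evI (ev_ge (MP m).1) (ev_ge (MP n).1)).
  apply: le_trans (dot_qf_trans (ip x) _ (M' x y h) _) _.
  rewrite qfBC//; have := (MP m).2 _ AM' mM; have := (MP n).2 _ AM' nM; move: Nm Nn.
  set a := m.+1%:R^-1; set b := n.+1%:R^-1; lra.
exists v => e e0; have e4 : 0 < e / 4 by rewrite divr_gt0.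
have [N1 H1] := vP _ e4; have [N2 H2] := inv_succ_small e4.
pose n := maxn N1 N2.
have {}H1 := H1 n (leq_maxl _ _); have {}H2 := H2 n (leq_maxr _ _).
apply: evW (ev_ge (MP n).1) => M' AM' le.
apply: le_trans (dot_qf_trans (ip x) _ (M n x y h) _) _.
have := (MP n).2 _ AM' le; move: H1 H2.
rewrite (qfBC _ v)// (qfBC _ (M n x y h) (M' x y h))//.
set a := n.+1%:R^-1; lra.
Qed.

(** The entrywise limits inherit adjoints, which makes them a Hermitian kernel;
    Gram values converge as finite sums of entries. *)
Lemma chain_limit : exists2 V, hermitian_kernel V &
  forall u e, 0 < e -> exists2 M0, A M0 & forall M, A M -> positive (M - M0) ->
    `|gramq V u - gramq M u| <= e.
Proof.
pose v x y h := projT1 (cid (@entry_limit x y h)).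
have vP x y h e : 0 < e -> ev (fun M => qf (ip x) (v x y h - M x y h) <= e).
  by rewrite /v; case: cid => w wP; exact: wP.
have vadj x y : is_adjoint (ip y) (ip x) (v x y) (v y x).
  move=> h l; apply/eqP; rewrite -subr_eq0; apply/eqP/sq_eq0/eqP.
  rewrite eq_le sq_ge0 andbT.
  apply: (@le0_of_small _ _ (2 * qf (ip x) l + 2 * qf (ip y) h)) => [|e e0].
    by rewrite addr_ge0// mulr_ge0.
  have [M AM [M1 M2]] := ev_ex (evI (vP x y h e e0) (vP y x l e e0)).
  have -> : ip x (v x y h) l - ip y h (v y x l) =
      ip x (v x y h - M x y h) l + ip y h (M y x l - v y x l).
    by rewrite hformBl// hformBr// -((A_pos AM).1 x y h l) addrA subrK.
  apply: le_trans (sqDle _ _) _; rewrite mulrDr !(mulrCA e); apply: lerD.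
    rewrite ler_pM2l//; apply: le_trans (hform_cs _ _ _ _) _ => //.
    by rewrite ler_wpM2r.
  rewrite ler_pM2l//; apply: le_trans (hform_cs _ _ _ _) _ => //.
  by rewrite mulrC ler_wpM2r// qfBC.
have [V VE] := kernel_of_adjoints vadj.
exists V; first by move=> x y h l; rewrite !VE; exact: vadj.
pose cv (phi : opKernel H -> R) := forall e, 0 < e ->
  ev (fun M => `|phi V - phi M| <= e).
have cv_sum I (s : seq I) (phi : I -> opKernel H -> R) : (forall i, cv (phi i)) ->
    cv (fun M => \sum_(i <- s) phi i M).
  move=> cphi; elim: s => [|i s IH] e e0.
    have [M0 AM0] := A_ne; exists M0 => // M _ _.
    by rewrite !big_nil subrr normr0 ltW.
  have e2 : 0 < e / 2 by rewrite divr_gt0.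
  apply: evW (evI (cphi i _ e2) (IH _ e2)) => M AM [h1 h2].
  rewrite !big_cons opprD addrACA (le_trans (ler_normD _ _))//.
  by rewrite [leRHS](splitr e) lerD.
have cv_entry x y (h : H y) (l : H x) : cv (fun M => re (ip x (M x y h) l)).
  move=> e e0; have c1 : 0 < qf (ip x) l + 1 by rewrite ltr_wpDl.
  apply: evW (vP x y h (e ^+ 2 / (qf (ip x) l + 1)) _).
    move=> M AM; rewrite -VE -raddfB -hformBl//.
    rewrite ler_pdivlMr// => le.
    rewrite -(ler_pXn2r (isT : (0 < 2)%N)) ?nnegrE ?(ltW e0)// real_normK ?num_real//.
    apply: le_trans (re_hform_cs _ _ _ _) _ => //.
    apply: le_trans le; rewrite ler_wpM2l// lerDl//.
  by rewrite divr_gt0// exprn_gt0.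
move=> u e e0.
have := cv_sum _ u (fun q M => \sum_(p <- u)
  re (ip (tag q) (M (tag q) (tag p) (tagged p)) (tagged q))) _ e e0.
have E M : gramq M u = \sum_(q <- u) \sum_(p <- u)
  re (ip (tag q) (M (tag q) (tag p) (tagged p)) (tagged q)).
  by rewrite /gramq gramE raddf_sum; apply: eq_bigr => q _; rewrite raddf_sum.
case=> [q|M0 AM0 H0]; first exact: cv_sum.
by exists M0 => // M AM le; rewrite !E; exact: H0.
Qed.

Lemma chain_upper_bound : exists V,
  [/\ positive V, forall M, A M -> positive (V - M) &
      forall L, (forall M, A M -> positive (L - M)) -> positive (L - V)].
Proof.
have [V hV VP] := chain_limit.
have lim u e : 0 < e -> exists2 M0, A M0 & forall M, A M -> positive (M - M0) ->
    gramq V u <= gramq M u + e /\ gramq M u <= gramq V u + e.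
  move=> e0; have [M0 AM0 HM] := VP u e e0; exists M0 => // M AM /(HM M AM).
  by rewrite ler_distl => /andP[]; lra.
have VM M : A M -> positive (V - M).
  move=> AM; split=> [|u]; first exact: hermitianB hV (A_pos AM).1.
  rewrite gramqB; apply/ler_addgt0Pr => e e0.
  have [M0 AM0 HM] := lim u e e0.
  have [M' AM' [M1 M2]] := ev_ex (evI (ev_ge AM) (ev_ge AM0)).
  have := M1.2 u; rewrite gramqB; have [_] := HM _ AM' M2; lra.
have [M0 AM0] := A_ne.
exists V; split => //.
  by rewrite -[V](subrK M0); exact: positiveD (VM _ AM0) (A_pos AM0).
move=> L LA; split=> [|u].
  have hL : hermitian_kernel L.
    by rewrite -[L](subrK M0); exact: hermitianD (LA _ AM0).1 (A_pos AM0).1.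
  exact: hermitianB.
rewrite gramqB; apply/ler_addgt0Pr => e e0; have [M AM HM] := lim u e e0.
have [|+ _] := HM M AM; first by rewrite subrr; exact: positive0.
by have := (LA _ AM).2 u; rewrite gramqB; lra.
Qed.

End Chain.

(** A maximal common minorant [M] exists by Zorn; a common minorant [L] of
    [K1 - M] and [K2 - M] would make [M + L] a larger one. *)
Lemma maximal_common_part K1 K2 : positive K1 -> positive K2 -> exists M,
  [/\ positive (K1 - M), positive (K2 - M) & forall L, positive L ->
      positive (K1 - M - L) -> positive (K2 - M - L) -> L = 0].
Proof.
move=> p1 p2.
pose T := {M | [/\ positive M, positive (K1 - M) & positive (K2 - M)]}.
have t0P : [/\ positive 0, positive (K1 - 0) & positive (K2 - 0)].
  by rewrite !subr0; split=> //; exact: positive0.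
pose rel (s t : T) := `[< positive (sval t - sval s) >].
have [||A A_tot|[M [pM M1 M2]] Mmax] := @ZL_preorder T (exist _ 0 t0P) rel.
- by move=> t; apply/asboolP; rewrite subrr; exact: positive0.
- move=> r s t /asboolP rs /asboolP st; apply/asboolP; exact: positive_trans rs st.
- have [A0|A0] := pselect (A = set0).
    by exists (exist _ 0 t0P) => s; rewrite A0.
  pose A' := [set sval t | t in A].
  have [||||V [pV VA VL]] := @chain_upper_bound K1 A'.
  + by move=> _ [[M [pM ? ?]] _ <-].
  + by move=> _ [[M [? pM ?]] _ <-].
  + by move=> _ _ [s As <-] [s' As' <-]; case: (A_tot _ _ As As') => /asboolP; [left|right].
  + by have /eqP/set0P[s As] := A0; exists (sval s), s.
  have PV : [/\ positive V, positive (K1 - V) & positive (K2 - V)].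
    by split=> //; apply: VL => _ [[M [? ? ?]] _ <-].
  by exists (exist _ V PV) => s As; apply/asboolP/VA; exists s.
exists M; split=> // L pL L1 L2.
have P : [/\ positive (M + L), positive (K1 - (M + L)) & positive (K2 - (M + L))].
  by rewrite !opprD !addrA; split=> //; exact: positiveD.
have /asboolP /= : rel (exist _ _ P) (exist _ M (And3 pM M1 M2)).
  by apply: Mmax; apply/asboolP => /=; rewrite addrAC subrr add0r.
rewrite opprD addrA subrr add0r => -[_ nL].
apply: psd_le0; first exact: pL.1.
by move=> u; apply/eqP; rewrite eq_le pL.2 andbT -oppr_ge0 -gramqN.
Qed.

End Maximal.

(** * Packing forms and subspaces into structures *)

Section Packing.
Variables (R : realType) (k : scalar_kind) (V : lmodType (scalarField R k)).
Local Notation F := (scalarField R k).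
Local Notation conj := (sconj R k).

Lemma hform_bilinear (b : V -> V -> F) : hform b ->
  bilinear_for *%R (conj \; *%R) b.
Proof.
move=> hb; split=> u c x y /=; first by rewrite (hformDl hb) (hformZl hb).
by rewrite hformDr// hformZr.
Qed.

Lemma hform_hermitian (b : V -> V -> F) : hform b ->
  forall x y, b x y = (-1) ^+ false * conj (b y x).
Proof. by move=> hb x y; rewrite expr0 mul1r; exact: hformC. Qed.

Lemma pack_hermitian (b : V -> V -> F) : hform b ->
  exists B : {hermitian_sym V for conj}, (B : V -> V -> F) = b.
Proof.
move=> hb.
pose B : {hermitian_sym V for conj} := HB.pack b
  (bilinear_isBilinear.Build _ _ _ _ _ _ b (hform_bilinear hb))
  (isHermitianSesquilinear.Build _ _ _ _ b (hform_hermitian hb)).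
by exists B.
Qed.

Lemma pack_dot (b : V -> V -> F) : hform b -> (forall x, 0 <= qf b x) ->
  (forall x, qf b x = 0 -> x = 0) -> exists B : {dot V for conj}, (B : V -> V -> F) = b.
Proof.
move=> hb b0 bI.
have pb x : x != 0 -> 0 < b x x.
  move=> x0; rewrite (qfE hb) emb_gt0 lt_neqAle b0 andbT eq_sym.
  by apply: contra x0 => /eqP/bI ->.
pose B : {dot V for conj} := HB.pack b
  (bilinear_isBilinear.Build _ _ _ _ _ _ b (hform_bilinear hb))
  (isHermitianSesquilinear.Build _ _ _ _ b (hform_hermitian hb))
  (isDotProduct.Build _ _ b pb).
by exists B.
Qed.

Lemma pack_submod (D : set V) : D 0 -> (forall x y, D x -> D y -> D (x + y)) ->
  (forall c x, D x -> D (c *: x)) ->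
  exists E : submodClosed V, forall x, (x \in E) = `[< D x >].
Proof.
move=> D0 DD DZ; pose P : {pred V} := fun v => `[< D v >].
have PC : submod_closed P.
  split; first exact/asboolP.
  by move=> c x y /asboolP Dx /asboolP Dy; apply/asboolP/DD => //; exact: DZ.
pose E : submodClosed V := HB.pack P (GRing.isSubmodClosed.Build _ _ _ PC).
by exists E.
Qed.

End Packing.

(** * Completeness of the scalars *)

Section ScalarComplete.
Variable R : realType.

Lemma real_complete (s : nat -> R) :
  (forall e, 0 < e -> exists N, forall m n, (N <= m)%N -> (N <= n)%N ->
    (s m - s n) ^+ 2 <= e) ->
  exists l, forall e, 0 < e -> exists N, forall n, (N <= n)%N -> (s n - l) ^+ 2 <= e.
Proof.
move=> sC.
have sqr_lt (x e : R) : 0 < e -> x ^+ 2 <= e ^+ 2 / 4 -> `|x| < e.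
  move=> e0 le; rewrite -(ltr_pXn2r (isT : (0 < 2)%N)) ?nnegrE ?(ltW e0)//.
  rewrite real_normK ?num_real// (le_lt_trans le)// ltr_pdivrMr//.
  by rewrite ltr_pMr ?exprn_gt0// ltr1n.
have /cauchy_cvgP /(cvg_ex _)[l sl] : cauchy (s @ \oo).
  apply/cauchyP => e e0.
  have [|N HN] := sC (e ^+ 2 / 4); first by rewrite divr_gt0 ?exprn_gt0.
  exists (s N); exists N => // n /= Nn.
  by rewrite -ball_normE /=; apply: sqr_lt => //; exact: HN.
exists l => e e0.
have se : 0 < Num.sqrt e by rewrite sqrtr_gt0.
have [N _ HN] := (cvgrPdist_lt _ _).1 sl _ se; exists N => n /HN /ltW le.
rewrite -(sqr_sqrtr (ltW e0)) -real_normK ?num_real// distrC.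
by rewrite ler_pXn2r ?nnegrE// sqrtr_ge0.
Qed.

Lemma scalar_complete k (s : nat -> scalarField R k) :
  (forall e, 0 < e -> exists N, forall m n, (N <= m)%N -> (N <= n)%N ->
    sq (s m - s n) <= e) ->
  exists l, forall e, 0 < e -> exists N, forall n, (N <= n)%N -> sq (s n - l) <= e.
Proof.
case: k s => s; rewrite /sq /re /sconj /=.
  by move=> sC; case: (@real_complete s) => [e /sC //|l sl]; exists l.
have E (x y : R[i]) : complex.Re ((x - y) * ((x - y)^*)%C) =
    (complex.Re x - complex.Re y) ^+ 2 + (complex.Im x - complex.Im y) ^+ 2.
  by case: x y => [a b] [c d] /=; ring.
move=> sC.
have [|a sa] := @real_complete (fun n => complex.Re (s n)).
  move=> e /sC[N HN]; exists N => m n Nm Nn; apply: le_trans (HN m n Nm Nn).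
  by rewrite [leRHS]E lerDl sqr_ge0.
have [|b sb] := @real_complete (fun n => complex.Im (s n)).
  move=> e /sC[N HN]; exists N => m n Nm Nn; apply: le_trans (HN m n Nm Nn).
  by rewrite [leRHS]E lerDr sqr_ge0.
exists (a +i* b)%C => e e0; have e2 : 0 < e / 2 by rewrite divr_gt0.
have [N1 H1] := sa _ e2; have [N2 H2] := sb _ e2.
exists (maxn N1 N2) => n; rewrite geq_max => /andP[n1 n2].
by rewrite [leLHS]E (splitr e) lerD// ?H1// H2.
Qed.

End ScalarComplete.

(** * The reproducing kernel Hilbert space of a positive kernel *)

Section RKHS.
Variables (R : realType) (k : scalar_kind) (Y : choiceType).
Variable H : Y -> hilbertSpace R k.
Local Notation F := (scalarField R k).
Local Notation conj := (sconj R k).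
Local Notation ip y := (inner (H y)).
Variable K : opKernel H.
Hypothesis Kpos : positive K.
Implicit Types (f g h : sections H) (u v w : combo H) (c d e : R).
Let hK : hermitian_kernel K := Kpos.1.
Let pK u : 0 <= gramq K u := Kpos.2 u.

(** The squared norm of the functional [pairing f], for the seminorm that [K]
    puts on combos, is at most [c]. *)
Definition bnd f c := forall u, sq (pairing f u) <= c * gramq K u.

(** The functionals [bnd]-approximable by combos form the completion of the
    span of the kernel sections, realized inside the sections. *)
Definition rkhs_mem f :=
  forall e, 0 < e -> exists w, bnd (f - combo_section K w) e.

Lemma bndD f g c d : bnd f c -> bnd g d -> bnd (f + g) (2 * c + 2 * d).
Proof.
move=> fc gd u; rewrite pairingD (le_trans (sqDle _ _))//.
have := fc u; have := gd u; lra.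
Qed.

Lemma bndZ (a : F) f c : bnd f c -> bnd (a *: f) (sq a * c).
Proof. by move=> fc u; rewrite pairingZ sqM -mulrA ler_wpM2l ?sq_ge0. Qed.

Lemma bndN f c : bnd f c -> bnd (- f) c.
Proof. by move=> fc u; rewrite pairingN sqN. Qed.

Lemma bndB f g c d : bnd f c -> bnd g d -> bnd (f - g) (2 * c + 2 * d).
Proof. by move=> fc /bndN; exact: bndD. Qed.

Lemma bnd_le f c d : c <= d -> bnd f c -> bnd f d.
Proof. by move=> cd fc u; rewrite (le_trans (fc u))// ler_wpM2r. Qed.

Lemma bnd_combo w : bnd (combo_section K w) (gramq K w).
Proof. by move=> u; exact: gram_cs. Qed.

Lemma gramq_le_bnd w c : 0 <= c -> bnd (combo_section K w) c -> gramq K w <= c.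
Proof.
move=> c0 /(_ w); rewrite -/(gram K w w) gramqE// sq_emb => le.
have [->//|wp] := eqVneq (gramq K w) 0.
have {}wp : 0 < gramq K w by rewrite lt_neqAle eq_sym wp pK.
by rewrite -(ler_pM2r wp) -expr2.
Qed.

Definition diff_combo v w : combo H := v ++ scale_combo (- 1) w.

Lemma combo_section_diff v w :
  combo_section K (diff_combo v w) = combo_section K v - combo_section K w.
Proof. by rewrite combo_section_cat combo_section_scale scaleN1r. Qed.

Lemma pairing_diff f v w : pairing f (diff_combo v w) = pairing f v - pairing f w.
Proof. by rewrite pairing_cat pairing_scale rmorphN rmorph1 mulN1r. Qed.

Lemma approx_close f v w c d : 0 <= c -> 0 <= d ->
  bnd (f - combo_section K v) c -> bnd (f - combo_section K w) d ->
  gramq K (diff_combo v w) <= 2 * c + 2 * d.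
Proof.
move=> c0 d0 vc wd; apply: gramq_le_bnd; first by rewrite addr_ge0// mulr_ge0.
rewrite combo_section_diff addrC.
have -> : 2 * c + 2 * d = 2 * d + 2 * c by rewrite addrC.
have -> : - combo_section K w + combo_section K v =
  (f - combo_section K w) - (f - combo_section K v).
  by rewrite opprB [RHS]addrC addrA subrK addrC.
exact: bndB.
Qed.

Lemma approx_gramq f w c d : 0 <= c -> 0 <= d ->
  bnd f c -> bnd (f - combo_section K w) d -> gramq K w <= 2 * c + 2 * d.
Proof.
move=> c0 d0 fc wd; apply: gramq_le_bnd; first by rewrite addr_ge0// mulr_ge0.
have -> : combo_section K w = f - (f - combo_section K w) by rewrite opprB addrC subrK.
exact: bndB.
Qed.

Lemma rkhs_mem_combo w : rkhs_mem (combo_section K w).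
Proof.
move=> e e0; exists w; rewrite subrr => u.
by rewrite pairing0 sq0 mulr_ge0// ltW.
Qed.

Lemma rkhs_mem0 : rkhs_mem 0.
Proof.
have -> : 0 = combo_section K [::].
  by apply: functional_extensionality_dep => y; rewrite /combo_section big_nil.
exact: rkhs_mem_combo.
Qed.

Lemma rkhs_memD f g : rkhs_mem f -> rkhs_mem g -> rkhs_mem (f + g).
Proof.
move=> Df Dg e e0; have e4 : 0 < e / 4 by rewrite divr_gt0.
have [v fv] := Df _ e4; have [w gw] := Dg _ e4; exists (v ++ w).
rewrite combo_section_cat opprD addrACA.
by apply: bnd_le (bndD fv gw); lra.
Qed.

Lemma rkhs_memZ (a : F) f : rkhs_mem f -> rkhs_mem (a *: f).
Proof.
move=> Df e e0; have a1 : 0 < sq a + 1 by rewrite ltr_wpDl// sq_ge0.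
have [w fw] := Df _ (divr_gt0 e0 a1); exists (scale_combo a w).
rewrite combo_section_scale -scalerBr; apply: bnd_le (bndZ a fw).
by rewrite mulrA ler_pdivrMr// mulrC ler_pM2l// lerDl.
Qed.

Lemma rkhs_mem_bnd f : rkhs_mem f -> exists2 c, 0 <= c & bnd f c.
Proof.
move=> /(_ 1 ltr01)[w fw]; exists (2 * 1 + 2 * gramq K w).
  by rewrite addr_ge0// mulr_ge0.
by rewrite -[f](subrK (combo_section K w)); exact: bndD fw (bnd_combo w).
Qed.

(** The graph of the inner product of [f] and [g]: its value is the limit of
    [pairing f w] as the combos [w] approximate [g]. *)
Definition rkhs_ip f g (z : F) := forall e, 0 < e ->
  exists2 d, 0 < d & forall w, bnd (g - combo_section K w) d -> sq (pairing f w - z) <= e.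

Lemma rkhs_ip_combo f u : rkhs_mem f -> rkhs_ip f (combo_section K u) (pairing f u).
Proof.
move=> /rkhs_mem_bnd[c c0 fc] e e0; have c1 : 0 < c + 1 by rewrite ltr_wpDl.
exists (e / (c + 1)) => [|w]; first exact: divr_gt0.
rewrite -combo_section_diff => /gramq_le_bnd le.
have {}le := le (ltW (divr_gt0 e0 c1)).
have -> : pairing f w - pairing f u = - pairing f (diff_combo u w).
  by rewrite pairing_diff opprB.
rewrite sqN (le_trans (fc _))//; move: le; rewrite ler_pdivlMr//.
have := pK (diff_combo u w); nra.
Qed.

Lemma rkhs_ip_unique f g z z' : rkhs_mem g ->
  rkhs_ip f g z -> rkhs_ip f g z' -> z = z'.
Proof.
move=> Dg zP zP'; apply/eqP; rewrite -subr_eq0; apply/eqP/sq_eq0/eqP.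
rewrite eq_le sq_ge0 andbT; apply: (@le0_of_small _ _ 4) => // e e0.
have [d d0 dP] := zP e e0; have [d' d0' dP'] := zP' e e0.
have [|w gw] := Dg (Num.min d d'); first by rewrite lt_min d0.
have h1 : sq (pairing f w - z) <= e by apply: dP; apply: bnd_le gw; rewrite ge_min lexx.
have h2 : sq (pairing f w - z') <= e.
  by apply: dP'; apply: bnd_le gw; rewrite ge_min lexx orbT.
have -> : z - z' = (pairing f w - z') - (pairing f w - z) by rewrite opprB [RHS]addrC addrA subrK.
by rewrite (le_trans (sqDle _ _))// sqN; lra.
Qed.

Lemma rkhs_ip_exists f g : rkhs_mem f -> rkhs_mem g -> exists z, rkhs_ip f g z.
Proof.
move=> /rkhs_mem_bnd[c c0 fc] Dg.
have i0 n : 0 < n.+1%:R^-1 :> R by rewrite invr_gt0.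
have /choice[w wP] : forall n, exists w, bnd (g - combo_section K w) n.+1%:R^-1.
  by move=> n; exact: Dg.
have close v d n : 0 <= d -> bnd (g - combo_section K v) d ->
    sq (pairing f v - pairing f (w n)) <= c * (2 * d + 2 * n.+1%:R^-1).
  move=> d0 gv; rewrite -pairing_diff (le_trans (fc _))// ler_wpM2l//.
  by apply: approx_close gv (wP n) => //; exact: ltW.
have c1 : 0 < c + 1 by rewrite ltr_wpDl.
have [e e0|z zP] := @scalar_complete R k (fun n => pairing f (w n)).
  have [|N HN] := @inv_succ_small R (e / (4 * (c + 1))).
    by rewrite divr_gt0// mulr_gt0.
  exists N => m n /HN Nm /HN Nn.
  apply: le_trans (close _ _ n (ltW (i0 m)) (wP m)) _; move: Nm Nn.
  set a := m.+1%:R^-1; set b := n.+1%:R^-1 => ? ?.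
  have : c * (2 * a + 2 * b) <= (c + 1) * (4 * (e / (4 * (c + 1)))).
    have := i0 m; have := i0 n; rewrite -/a -/b => ? ?; nra.
  by rewrite [4 * _]mulrC mulrA; congr (_ <= _); field; rewrite gt_eqF.
exists z => e e0.
have e8 : 0 < e / (16 * (c + 1)) by rewrite divr_gt0// mulr_gt0.
exists (e / (16 * (c + 1))) => // v gv.
have [|N1 H1] := zP (e / 4); first by rewrite divr_gt0.
have [N2 H2] := inv_succ_small e8.
pose n := maxn N1 N2.
have {}H1 := H1 n (leq_maxl _ _); have {}H2 := H2 n (leq_maxr _ _).
have -> : pairing f v - z = (pairing f v - pairing f (w n)) + (pairing f (w n) - z).
  by rewrite addrA subrK.
rewrite (le_trans (sqDle _ _))//.
have := close _ _ n (ltW e8) gv; have := i0 n; move: H1 H2.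
set a := n.+1%:R^-1; set s := sq _; set t := sq _ => s4 a8 a0 tc.
have : c * (2 * (e / (16 * (c + 1))) + 2 * a) <= (c + 1) * (4 * (e / (16 * (c + 1)))).
  move: e8 a8; set q := e / _ => ? ?; nra.
have -> : (c + 1) * (4 * (e / (16 * (c + 1)))) = e / 4 by field; rewrite gt_eqF.
lra.
Qed.

Lemma rkhs_ipD f f' g z z' : rkhs_ip f g z -> rkhs_ip f' g z' ->
  rkhs_ip (f + f') g (z + z').
Proof.
move=> zP zP' e e0; have e4 : 0 < e / 4 by rewrite divr_gt0.
have [d d0 dP] := zP _ e4; have [d' d0' dP'] := zP' _ e4.
exists (Num.min d d') => [|w gw]; first by rewrite lt_min d0.
have h1 : sq (pairing f w - z) <= e / 4.
  by apply: dP; apply: bnd_le gw; rewrite ge_min lexx.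
have h2 : sq (pairing f' w - z') <= e / 4.
  by apply: dP'; apply: bnd_le gw; rewrite ge_min lexx orbT.
rewrite pairingD opprD addrACA (le_trans (sqDle _ _))//; lra.
Qed.

Lemma rkhs_ipZ (a : F) f g z : rkhs_ip f g z -> rkhs_ip (a *: f) g (a * z).
Proof.
move=> zP e e0; have a1 : 0 < sq a + 1 by rewrite ltr_wpDl// sq_ge0.
have [d d0 dP] := zP _ (divr_gt0 e0 a1); exists d => // w /dP.
rewrite ler_pdivlMr// pairingZ -mulrBr sqM; apply: le_trans.
by rewrite mulrC ler_wpM2l ?sq_ge0// lerDl.
Qed.

Lemma rkhs_ipC f g z : rkhs_mem f -> rkhs_mem g -> rkhs_ip f g z ->
  rkhs_ip g f (conj z).
Proof.
move=> /rkhs_mem_bnd[c c0 fc] Dg zP e e0.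
have [b b0 gb] := rkhs_mem_bnd Dg.
have e10 : 0 < e / 10 by rewrite divr_gt0.
have [d d0 dP] := zP _ e10.
pose C := 2 * c + 2 * b + 2; have C0 : 0 < C by rewrite /C; lra.
pose t := Num.min 1 (e / (10 * C)).
have t0 : 0 < t by rewrite lt_min ltr01 divr_gt0// mulr_gt0.
have t1 : t <= 1 by rewrite ge_min lexx.
have tC : t * C <= e / 10.
  by rewrite -ler_pdivlMr// -mulrA -invfM ge_min lexx orbT.
exists t => // v fv.
have [|w gw] := Dg (Num.min d t); first by rewrite lt_min d0.
have gwd : bnd (g - combo_section K w) d by apply: bnd_le gw; rewrite ge_min lexx.
have gwt : bnd (g - combo_section K w) t by apply: bnd_le gw; rewrite ge_min lexx orbT.
have h1 := dP w gwd.
have h2 : sq (pairing g v - gram K w v) <= e / 10.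
  rewrite -pairingB (le_trans (gwt v))// (le_trans _ tC)// ler_wpM2l ?(ltW t0)//.
  apply: le_trans (approx_gramq c0 (ltW t0) fc fv) _; rewrite /C; lra.
have h3 : sq (pairing f w - gram K v w) <= e / 10.
  rewrite -pairingB (le_trans (fv w))// (le_trans _ tC)// ler_wpM2l ?(ltW t0)//.
  apply: le_trans (approx_gramq b0 (ltW t0) gb gwt) _; rewrite /C; lra.
have -> : pairing g v - conj z = (pairing g v - gram K w v) +
    (conj (pairing f w - z) - conj (pairing f w - gram K v w)).
  rewrite !rmorphB /= -(gramC w v hK); ring.
apply: le_trans (sqDle _ _) _.
have := sqDle (conj (pairing f w - z)) (- conj (pairing f w - gram K v w)).
rewrite sqN !sq_conj; lra.
Qed.

(** For [w] near [f], both [pairing f w] and [gramq K w] are near the squared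
    norm of [f]; positivity and the next bound are read off from this. *)
Lemma rkhs_ip_self f z : rkhs_mem f -> rkhs_ip f f z -> forall e, 0 < e -> exists w,
  `|re (pairing f w) - re z| <= e /\ `|re (pairing f w) - gramq K w| <= e.
Proof.
move=> Df zP e e0; have [c c0 fc] := rkhs_mem_bnd Df.
have e2 : 0 < e ^+ 2 by rewrite exprn_gt0.
have sqr_le (x : F) : sq x <= e ^+ 2 -> `|re x| <= e.
  move=> le; rewrite -(ler_pXn2r (isT : (0 < 2)%N)) ?nnegrE ?(ltW e0)//.
  by rewrite real_normK ?num_real// (le_trans (re_sq_le _)).
have [d d0 dP] := zP _ e2.
pose C := 2 * c + 2; have C0 : 0 < C by rewrite /C; lra.
pose t := Num.min 1 (e ^+ 2 / C).
have t0 : 0 < t by rewrite lt_min ltr01 divr_gt0.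
have t1 : t <= 1 by rewrite ge_min lexx.
have tC : t * C <= e ^+ 2 by rewrite -ler_pdivlMr// ge_min lexx orbT.
have [|w fw] := Df (Num.min d t); first by rewrite lt_min d0.
have fwt : bnd (f - combo_section K w) t by apply: bnd_le fw; rewrite ge_min lexx orbT.
exists w; rewrite /gramq -!raddfB; split; apply: sqr_le.
  by apply: dP; apply: bnd_le fw; rewrite ge_min lexx.
rewrite -pairingB (le_trans (fwt w))// (le_trans _ tC)// ler_wpM2l ?(ltW t0)//.
apply: le_trans (approx_gramq c0 (ltW t0) fc fwt) _; rewrite /C; lra.
Qed.

Lemma rkhs_ip_ge0 f z : rkhs_mem f -> rkhs_ip f f z -> 0 <= re z.
Proof.
move=> Df zP; apply/ler_addgt0Pr => e e0.
have [|w []] := rkhs_ip_self Df zP (e := e / 2); first by rewrite divr_gt0.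
rewrite !ler_distl => /andP[? ?] /andP[? ?]; have := pK w; lra.
Qed.

(** The norm of [f] is at most its norm as a functional: with [w] near [f],
    [|pairing f w|^2 <= c [w, w]_K] compares two quantities close to the square
    and to [c] times the squared norm of [f]. *)
Lemma rkhs_ip_le_bnd f z c : rkhs_mem f -> rkhs_ip f f z -> 0 <= c -> bnd f c ->
  re z <= c.
Proof.
move=> Df zP c0 fc; rewrite leNgt; apply/negP => lt.
pose e := (re z - c) / 4; have e0 : 0 < e by rewrite divr_gt0// subr_gt0.
have [w []] := rkhs_ip_self Df zP e0.
have := le_trans (re_sq_le _) (fc w).
set p := re _; set a := gramq K w => le; rewrite !ler_distl => /andP[? ?] /andP[? ?].
have ze : re z = c + 4 * e by rewrite /e; lra.
have pa : a <= p + e by lra.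
have pc : c + 3 * e <= p by lra.
have : p * (p - c) <= c * e.
  by rewrite mulrBr -expr2 lerBlDr (le_trans le)// [p * c]mulrC -mulrDr addrC ler_wpM2l.
nra.
Qed.

Lemma pairing_cvg (s : nat -> sections H) f :
  (forall y, qconv (qf (ip y)) (fun n => s n y) (f y)) ->
  forall u e, 0 < e -> exists N, forall n, (N <= n)%N -> sq (pairing (s n - f) u) <= e.
Proof.
move=> sf; elim=> [|[y h] u IH] e e0.
  by exists 0%N => n _; rewrite /pairing big_nil sq0 ltW.
have [|N1 H1] := IH (e / 4); first by rewrite divr_gt0.
have c1 : 0 < qf (ip y) h + 1 by rewrite ltr_wpDl.
have [|N2 H2] := sf y (e / 4 / (qf (ip y) h + 1)); first by rewrite !divr_gt0.
exists (maxn N1 N2) => n; rewrite geq_max => /andP[/H1 n1 /H2 n2].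
rewrite -cat1s pairing_cat pairing1 (le_trans (sqDle _ _))//.
have : sq (ip y ((s n - f) y) h) <= e / 4.
  apply: le_trans (hform_cs _ _ _ _) _ => //; move: n2; rewrite ler_pdivlMr//.
  by apply: le_trans; rewrite ler_wpM2l// lerDl.
lra.
Qed.

(** Completeness holds because a Cauchy sequence converges at each point and
    bounds on functionals pass to pointwise limits. *)
Theorem rkhs_exists : exists (D : submodClosed (sections H))
    (p : {dot (subspace_of D) for conj}),
  [/\ qcomplete (qf p), forall u, combo_section K u \in D &
      forall u (Ku : subspace_of D), val Ku = combo_section K u ->
        forall f : subspace_of D, pairing (val f) u = p f Ku].
Proof.
have [D DE] := pack_submod rkhs_mem0 rkhs_memD rkhs_memZ.
pose E := subspace_of D.
have mem (f : E) : rkhs_mem (val f) by apply/asboolP; rewrite -DE; exact: valP.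
pose b (f g : E) := projT1 (cid (rkhs_ip_exists (mem f) (mem g))).
have bP (f g : E) : rkhs_ip (val f) (val g) (b f g) by rewrite /b; case: cid.
have bE (f g : E) z : rkhs_ip (val f) (val g) z -> b f g = z.
  by move=> zP; exact: rkhs_ip_unique (mem g) (bP f g) zP.
have hb : hform b.
  split=> [f g h|c f g|f g]; apply: bE.
  - by rewrite raddfD; exact: rkhs_ipD (bP _ _) (bP _ _).
  - by rewrite linearZ; exact: rkhs_ipZ (bP _ _).
  - exact: rkhs_ipC (mem _) (mem _) (bP _ _).
have b0 (f : E) : 0 <= qf b f by exact: rkhs_ip_ge0 (mem f) (bP f f).
have memK u : combo_section K u \in D by rewrite DE; apply/asboolP/rkhs_mem_combo.
pose ks u : E := exist (fun f => f \in D) _ (memK u).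
have repr u (Ku : E) : val Ku = combo_section K u -> forall f : E, pairing (val f) u = b f Ku.
  by move=> KuE f; apply/esym/bE; rewrite KuE; exact: rkhs_ip_combo.
have qks u : qf b (ks u) = gramq K u by rewrite /qf -(repr u (ks u)).
have bndE (f : E) : bnd (val f) (qf b f).
  by move=> u; rewrite (repr u (ks u))// -qks; exact: hform_cs.
have val_le y : exists2 C, 0 <= C & forall f : E, qf (ip y) (val f y) <= C * qf b f.
  have [C C0 CK] := diag_bounded K y; exists C => // g.
  have := bndE g [:: existT _ y (val g y)].
  rewrite pairing1 gramq1 (qfE (dot_hform (ip y))) sq_emb => le.
  have [->|gp] := eqVneq (qf (ip y) (val g y)) 0; first exact: mulr_ge0.
  have {}gp : 0 < qf (ip y) (val g y) by rewrite lt_neqAle eq_sym gp dot_qf_ge0.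
  rewrite -(ler_pM2r gp) -expr2 (le_trans le)//.
  by rewrite mulrAC mulrC ler_wpM2r// mulrC.
have bI (f : E) : qf b f = 0 -> f = 0.
  move=> q0; apply: val_inj; apply: functional_extensionality_dep => y.
  have [C C0 /(_ f)] := val_le y; rewrite q0 mulr0 => le.
  by apply: (@dot_qf_eq0 _ _ _ (ip y)); apply/eqP; rewrite eq_le le dot_qf_ge0.
have [p pE] := pack_dot hb b0 bI.
exists D, p; rewrite pE; split=> // s sC.
have ptC y : qcauchy (qf (ip y)) (fun n => val (s n) y).
  have [C C0 CP] := val_le y; have C1 : 0 < C + 1 by rewrite ltr_wpDl.
  move=> e e0; have [N HN] := sC _ (divr_gt0 e0 C1).
  exists N => m n Nm Nn; have := HN m n Nm Nn; rewrite ler_pdivlMr// => le.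
  have -> : val (s m) y - val (s n) y = val (s m - s n) y by rewrite raddfB.
  apply: le_trans (CP _) _; rewrite mulrC (le_trans _ le)// ler_wpM2l// lerDl//.
pose l : sections H := fun y => projT1 (cid (inner_qcomplete (ptC y))).
have lP y : qconv (qf (ip y)) (fun n => val (s n) y) (l y).
  by rewrite /l; case: cid.
have bl e : 0 < e -> exists N, forall n, (N <= n)%N -> bnd (val (s n) - l) e.
  move=> e0; have [N HN] := sC (e / 4) (divr_gt0 e0 (ltr0n _ 4)); exists N => n Nn u.
  apply/ler_addgt0Pr => d d0.
  have [|N' HN'] := @pairing_cvg (fun n => val (s n)) l lP u (d / 2).
    by rewrite divr_gt0.
  pose m := maxn N N'.
  have h1 := HN n m Nn (leq_maxl _ _); have h2 := HN' m (leq_maxr _ _).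
  have -> : val (s n) - l = val (s n - s m) + (val (s m) - l).
    by rewrite raddfB addrA subrK.
  rewrite pairingD (le_trans (sqDle _ _))//.
  have := bndE (s n - s m) u; have := pK u; move: h2 h1 => /=.
  move: (sq _) (sq _) (qf _ _) (gramq _ _) => *; nra.
have Dl : rkhs_mem l.
  move=> e e0; have e4 : 0 < e / 4 by rewrite divr_gt0.
  have [N HN] := bl _ e4; have [w sw] := mem (s N) _ e4; exists w.
  have -> : l - combo_section K w = (val (s N) - combo_section K w) - (val (s N) - l).
    by rewrite opprB [RHS]addrC addrA subrK.
  by apply: bnd_le (bndB sw (HN N (leqnn N))); lra.
have lD : l \in D by rewrite DE; exact/asboolP.
exists (exist (fun f => f \in D) l lD : E) => e e0; have [N HN] := bl e e0; exists N => n Nn.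
apply: rkhs_ip_le_bnd (mem _) (bP _ _) (ltW e0) _.
by rewrite raddfB; exact: HN.
Qed.

End RKHS.

(** * Krein spaces from disjoint kernels *)

Section DisjointKernels.
Variables (R : realType) (k : scalar_kind) (Y : choiceType).
Variable H : Y -> hilbertSpace R k.
Local Notation F := (scalarField R k).
Local Notation conj := (sconj R k).
Local Notation ip y := (inner (H y)).
Implicit Types (K L : opKernel H).

(** A section bounded for both kernels yields the rank one common minorant
    [h |-> c^-1 <h, f y> f x]. *)
Lemma bnd_disjoint K1 K2 (f : sections H) c : positive K1 -> positive K2 ->
  (forall L, positive L -> positive (K1 - L) -> positive (K2 - L) -> L = 0) ->
  0 < c -> bnd K1 f c -> bnd K2 f c -> f = 0.
Proof.
move=> p1 p2 dis c0 f1 f2.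
have cE : conj (emb k c^-1) = emb k c^-1 by exact: conj_emb.
pose M x y (h : H y) : H x := (emb k c^-1 * ip y h (f y)) *: f x.
have [|L LE] := @kernel_of_adjoints _ _ _ H M.
  move=> x y h l; rewrite /M (hformZl (dot_hform _)) hformZr// rmorphM /= cE -ipC; ring.
have hL : hermitian_kernel L.
  move=> x y h l; rewrite !LE /M (hformZl (dot_hform _)) hformZr// rmorphM /= cE -ipC; ring.
have gE u : gramq L u = c^-1 * sq (pairing f u).
  rewrite /gramq gramE -(re_emb k (_ * _)) rmorphM /= emb_sq {2}/pairing rmorph_sum.
  congr (re _); rewrite /pairing mulr_suml mulr_sumr; apply: eq_bigr => q _.
  rewrite !mulr_sumr; apply: eq_bigr => p _.
  rewrite LE /M (hformZl (dot_hform _)) -ipC; ring.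
have pL : positive L.
  by split=> // u; rewrite gE mulr_ge0 ?sq_ge0// invr_ge0 ltW.
have min K : positive K -> bnd K f c -> positive (K - L).
  move=> [hK pK] fK; split; first exact: hermitianB.
  by move=> u; rewrite gramqB subr_ge0 gE mulrC ler_pdivrMr// mulrC.
have L0 := dis L pL (min _ p1 f1) (min _ p2 f2).
apply: functional_extensionality_dep => y.
have := gE [:: existT _ y (f y)]; rewrite L0 /gramq gram0 raddf0 pairing1.
move=> /esym/eqP; rewrite mulf_eq0 invr_eq0 gt_eqF//= => /eqP/sq_eq0.
exact: ip_eq0.
Qed.

Lemma rkhs_bnd K (D : submodClosed (sections H)) (p : {dot (subspace_of D) for conj}) :
  (forall u, combo_section K u \in D) ->
  (forall u (Ku : subspace_of D), val Ku = combo_section K u ->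
     forall f : subspace_of D, pairing (val f) u = p f Ku) ->
  forall f : subspace_of D, bnd K (val f) (qf p f).
Proof.
move=> memK repr f u.
pose Ku : subspace_of D := exist (fun f => f \in D) _ (memK u).
rewrite (repr u Ku)//; have -> : gramq K u = qf p Ku by rewrite /qf -(repr u Ku).
by apply: hform_cs => // x; exact: dot_qf_ge0.
Qed.

(** The reproducing kernel Hilbert spaces of disjoint kernels meet only in [0],
    so their sum is direct; the sign change on the second summand is a
    fundamental symmetry, and the kernel of the resulting form is [K1 - K2]. *)
Theorem krein_of_disjoint K1 K2 : positive K1 -> positive K2 ->
  (forall L, positive L -> positive (K1 - L) -> positive (K2 - L) -> L = 0) ->
  exists (D : submodClosed (sections H)) (b : {hermitian_sym (subspace_of D) for conj}),
    krein_form b /\ reproducing (K1 - K2) b.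
Proof.
move=> p1 p2 dis.
have [D1 [ip1 [c1 m1 r1]]] := rkhs_exists p1.
have [D2 [ip2 [c2 m2 r2]]] := rkhs_exists p2.
have cap0 (f : sections H) : f \in D1 -> f \in D2 -> f = 0.
  move=> f1 f2.
  have := rkhs_bnd m1 r1 (exist (fun f => f \in D1) f f1).
  have := rkhs_bnd m2 r2 (exist (fun f => f \in D2) f f2).
  move: (qf _ _) (qf _ _) (dot_qf_ge0 ip2 (exist _ f f2)) (dot_qf_ge0 ip1 (exist _ f f1)).
  move=> c d c0 d0 fc fd; apply: (bnd_disjoint p1 p2 dis (c := c + d + 1)).
  - by rewrite ltr_wpDl// addr_ge0.
  - by apply: bnd_le fd => //; lra.
  - by apply: bnd_le fc => //; lra.
pose E1 := subspace_of D1; pose E2 := subspace_of D2.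
have [|||D DE] := @pack_submod _ _ (sections H)
  [set f | exists fg : E1 * E2, f = val fg.1 + val fg.2].
- by exists (0, 0); rewrite !raddf0 addr0.
- move=> _ _ [[f1 f2] ->] [[g1 g2] ->]; exists (f1 + g1, f2 + g2) => /=.
  by rewrite addrACA.
- by move=> c _ [[f1 f2] ->]; exists (c *: f1, c *: f2); rewrite /= scalerDr.
pose E := subspace_of D.
have split_ex (f : E) : exists fg : E1 * E2, val f = val fg.1 + val fg.2.
  by apply/asboolP; rewrite -DE; exact: valP.
pose d (f : E) := projT1 (cid (split_ex f)).
have dP (f : E) : val f = val (d f).1 + val (d f).2 by rewrite /d; case: cid.
have dE (f : E) (f1 : E1) (f2 : E2) : val f = val f1 + val f2 -> d f = (f1, f2).
  move=> e; have e0 : val ((d f).1 - f1) = val (f2 - (d f).2).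
    rewrite !raddfB; apply/eqP; rewrite subr_eq addrAC eq_sym subr_eq addrC -e.
    by rewrite dP.
  have z : val ((d f).1 - f1) = 0.
    by apply: cap0; [exact: valP | rewrite e0; exact: valP].
  have z1 : (d f).1 - f1 = 0 by exact: val_inj.
  have z2 : f2 - (d f).2 = 0 by apply: val_inj; rewrite -e0.
  by move/eqP: z1; move/eqP: z2; rewrite !subr_eq0 => /eqP -> /eqP <-; case: (d f).
have dD f g : d (f + g) = ((d f).1 + (d g).1, (d f).2 + (d g).2).
  by apply: dE; rewrite !raddfD addrACA -!dP.
have dZ c f : d (c *: f) = (c *: (d f).1, c *: (d f).2).
  by apply: dE; rewrite !linearZ /= -scalerDr -dP.
have dB f g : d (f - g) = ((d f).1 - (d g).1, (d f).2 - (d g).2).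
  by rewrite -scaleN1r dD dZ !scaleN1r.
have mem (f1 : E1) (f2 : E2) : val f1 + val f2 \in D by rewrite DE; apply/asboolP; exists (f1, f2).
pose mk (f1 : E1) (f2 : E2) : E := exist (fun f => f \in D) _ (mem f1 f2).
have dmk f1 f2 : d (mk f1 f2) = (f1, f2) by exact: dE.
pose bb (f g : E) : F := ip1 (d f).1 (d g).1 - ip2 (d f).2 (d g).2.
pose cc (f g : E) : F := ip1 (d f).1 (d g).1 + ip2 (d f).2 (d g).2.
have h1 := dot_hform ip1; have h2 := dot_hform ip2.
have hb : hform bb.
  split=> [f g h|c f h|f g]; rewrite /bb.
  - by rewrite dD (hformDl h1) (hformDl h2) opprD addrACA.
  - by rewrite dZ (hformZl h1) (hformZl h2) mulrBr.
  - by rewrite rmorphB /= -(hformC h1) -(hformC h2).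
have hc : hform cc.
  split=> [f g h|c f h|f g]; rewrite /cc.
  - by rewrite dD (hformDl h1) (hformDl h2) addrACA.
  - by rewrite dZ (hformZl h1) (hformZl h2) mulrDr.
  - by rewrite rmorphD /= -(hformC h1) -(hformC h2).
have qc f : qf cc f = qf ip1 (d f).1 + qf ip2 (d f).2 by rewrite /qf raddfD.
have cc0 f : 0 <= qf cc f by rewrite qc addr_ge0.
have ccI f : qf cc f = 0 -> f = 0.
  move=> /eqP; rewrite qc paddr_eq0// => /andP[/eqP/dot_qf_eq0 e1 /eqP/dot_qf_eq0 e2].
  by apply: val_inj; rewrite dP e1 e2 !raddf0 addr0.
have [b bE] := pack_hermitian hb; have [p pE] := pack_dot hc cc0 ccI.
have lJ : linear (fun f => mk (d f).1 (- (d f).2)).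
  move=> c f g; apply: val_inj => /=.
  by rewrite dD dZ /= opprD addrACA scalerBr.
pose J : {linear E -> E} := HB.pack (fun f => mk (d f).1 (- (d f).2))
  (GRing.isLinear.Build _ _ _ _ _ lJ).
exists D, b; split.
  constructor; apply: (@FundamentalSymmetry _ _ _ b J _ p).
  - by move=> f; apply: val_inj; rewrite /= dmk /= opprK -dP.
  - move=> f g; rewrite pE bE /cc /bb /= dmk /=.
    by rewrite (hformNl h2) opprK.
  - apply: ip_complete_q; rewrite pE => s sC.
    have [e /sC[N HN]|l1 l1P] := c1 (fun n => (d (s n)).1).
      exists N => m n Nm Nn; apply: le_trans (HN m n Nm Nn).
      by rewrite qc dB lerDl.
    have [e /sC[N HN]|l2 l2P] := c2 (fun n => (d (s n)).2).
      exists N => m n Nm Nn; apply: le_trans (HN m n Nm Nn).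
      by rewrite qc dB lerDr.
    exists (mk l1 l2) => e e0; have e2 : 0 < e / 2 by rewrite divr_gt0.
    have [N1 H1] := l1P _ e2; have [N2 H2] := l2P _ e2.
    exists (maxn N1 N2) => n; rewrite geq_max => /andP[n1 n2].
    by rewrite qc dB dmk (splitr e) lerD// ?H1// H2.
move=> x h.
pose u : combo H := [:: existT _ x h].
pose k1 : E1 := exist (fun f => f \in D1) _ (m1 u).
pose k2 : E2 := exist (fun f => f \in D2) _ (m2 u).
exists (mk k1 (- k2)).
  by rewrite /= !combo_section1.
move=> f; rewrite bE /bb dmk /= (hformNr h2) opprK -(r1 u k1)// -(r2 u k2)//.
by rewrite -pairingD -dP pairing1.
Qed.

End DisjointKernels.

(** * Finitely supported sections and combos *)

Section FinitelySupported.
Variables (R : realType) (k : scalar_kind) (Y : choiceType).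
Variable H : Y -> hilbertSpace R k.
Local Notation F := (scalarField R k).
Local Notation conj := (sconj R k).
Local Notation ip y := (inner (H y)).
Implicit Types (K L : opKernel H) (f g : sections H).

Definition section_combo (s : seq Y) f : combo H :=
  [seq existT (fun y => H y : Type) y (f y) | y <- s].

Definition point_section y (h : H y) : sections H := fun z =>
  if pselect (y = z) is left e then ecast t (H t) e h else 0.

(** The section that a combo stands for: entries at the same point are added. *)
Definition sum_section (u : combo H) : sections H :=
  \sum_(p <- u) point_section (tagged p).

Lemma point_section_id y (h : H y) : point_section h y = h.
Proof.
rewrite /point_section; case: pselect => // e.
by rewrite (Prop_irrelevance e erefl).
Qed.

Lemma point_section_neq y z (h : H y) : y != z -> point_section h z = 0.
Proof. by rewrite /point_section; case: pselect => // e /eqP. Qed.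

Lemma sum_sectionE u y : sum_section u y = \sum_(p <- u) point_section (tagged p) y.
Proof.
rewrite /sum_section; elim: u => [|p u IH]; first by rewrite !big_nil.
by rewrite !big_cons -IH.
Qed.

Lemma sum_section_supp u y : y \notin map tag u -> sum_section u y = 0.
Proof.
move=> yu; rewrite sum_sectionE big1_seq// => p /= pu.
apply: point_section_neq; apply: contra yu => /eqP <-; exact: map_f.
Qed.

Lemma sum_section_fs u : finitely_supported (sum_section u).
Proof.
apply: (@sub_finite_set _ _ [set` map tag u]); last exact: finite_seq.
move=> y /= fy; apply: contrapT => /negP /sum_section_supp //.
Qed.

Lemma pairing_sum_section u f (s : seq Y) : uniq s -> {subset map tag u <= s} ->
  pairing f (section_combo s (sum_section u)) = pairing f u.
Proof.
move=> us su; rewrite /pairing big_map /=.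
under eq_bigr => y _ do rewrite sum_sectionE linear_sumr.
rewrite exchange_big /=; apply: eq_big_seq => p pu.
have ts : tag p \in s by apply: su; exact: map_f.
rewrite (bigD1_seq (tag p))//= point_section_id big1 ?addr0// => y yp.
by rewrite point_section_neq 1?eq_sym// hform0r.
Qed.

Lemma gramq_sum_section K u (s : seq Y) : hermitian_kernel K -> uniq s ->
  {subset map tag u <= s} -> gramq K (section_combo s (sum_section u)) = gramq K u.
Proof.
move=> hK us su; rewrite /gramq /gram pairing_sum_section// -/(gram _ _ _).
by rewrite (gramC _ _ hK) re_conj /gram pairing_sum_section.
Qed.

Lemma kernel_formE K f g (s : seq Y) : uniq s ->
  (forall y, y \notin s -> f y = 0) -> (forall y, y \notin s -> g y = 0) ->
  kernel_form K f g = gram K (section_combo s f) (section_combo s g).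
Proof.
move=> us fs gs.
have sumE (G : Y -> F) : (forall y, y \notin s -> G y = 0) ->
    \sum_(y \in [set: Y]) G y = \sum_(y <- s) G y.
  move=> G0; rewrite (fsbig_seq _ _ us); apply/esym/fsbig_widen => // y [_ /= ys].
  by apply: G0; apply/negP.
rewrite /kernel_form sumE => [|y ys]; last first.
  by rewrite (fs _ ys); under eq_fsbigr do rewrite linear0 hform0l//; rewrite fsbig1.
rewrite gramE big_map exchange_big /=; rewrite [RHS]big_map /=.
by apply: eq_bigr => x _; rewrite sumE// => y ys; rewrite (gs _ ys) hform0r.
Qed.

Lemma finite_support_seq f g : finitely_supported f -> finitely_supported g ->
  exists s : seq Y, [/\ uniq s, forall y, y \notin s -> f y = 0 &
    forall y, y \notin s -> g y = 0].
Proof.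
move=> /finite_seqP[s1 E1] /finite_seqP[s2 E2]; exists (undup (s1 ++ s2)).
split=> [|y|y]; first exact: undup_uniq.
  rewrite mem_undup mem_cat negb_or => /andP[ys _]; apply: contrapT => fy.
  by have : [set` s1] y by [rewrite -E1]; rewrite /= (negbTE ys).
rewrite mem_undup mem_cat negb_or => /andP[_ ys]; apply: contrapT => fy.
by have : [set` s2] y by [rewrite -E2]; rewrite /= (negbTE ys).
Qed.

Lemma norm_le_ssqrt (z : F) (a b : R) : 0 <= a -> 0 <= b ->
  (`|z| <= ssqrt (emb k a) * ssqrt (emb k b)) = (sq z <= a * b).
Proof.
move=> a0 b0.
rewrite -(ler_pXn2r (isT : (0 < 2)%N)) ?nnegrE ?mulr_ge0 ?ssqrt_ge0 ?emb_ge0//.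
by rewrite exprMn !sqr_ssqrt ?emb_ge0// normsqE -rmorphM emb_le.
Qed.

(** Boundedness of [[.,.]_K] by the seminorm of [L] is the two-sided order
    bound: Cauchy-Schwarz one way, the diagonal the other way. *)
Lemma form_boundP K L : hermitian_kernel K -> positive L ->
  (forall f g, finitely_supported f -> finitely_supported g ->
     `|kernel_form K f g| <= ssqrt (kernel_form L f f) * ssqrt (kernel_form L g g)) <->
  (positive (K + L) /\ positive (L - K)).
Proof.
move=> hK [hL pL]; split=> [bd|[[_ KL] [_ LK]] f g ff fg].
  have le u : `|gramq K u| <= gramq L u.
    pose s := undup (map tag u).
    have su : {subset map tag u <= s} by move=> y; rewrite mem_undup.
    have us : uniq s by exact: undup_uniq.
    have f0 y : y \notin s -> sum_section u y = 0.
      by rewrite mem_undup; exact: sum_section_supp.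
    have := bd _ _ (sum_section_fs u) (sum_section_fs u).
    rewrite !(kernel_formE _ us)// !gramqE// !gramq_sum_section//.
    rewrite norm_le_ssqrt// sq_emb -expr2 -[X in X <= _]real_normK ?num_real//.
    by rewrite ler_pXn2r ?nnegrE.
  split; split=> [|u]; [exact: hermitianD| |exact: hermitianB|].
    by rewrite gramqD; have := le u; rewrite ler_norml => /andP[]; lra.
  by rewrite gramqB; have := le u; rewrite ler_norml => /andP[]; lra.
have [s [us f0 g0]] := finite_support_seq ff fg.
rewrite !(kernel_formE _ us)// !(gramqE _ hL) norm_le_ssqrt//.
apply: gram_cs2 => // v.
  by have := KL v; rewrite gramqD; lra.
by have := LK v; rewrite gramqB; lra.
Qed.

End FinitelySupported.

(** * Spans and closures *)

Section Spans.
Variables (R : realType) (k : scalar_kind) (U : lmodType (scalarField R k)).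
Local Notation F := (scalarField R k).

Lemma linear_span_closed (A : set U) : [/\ linear_span A 0,
  forall x y, linear_span A x -> linear_span A y -> linear_span A (x + y) &
  forall c x, linear_span A x -> linear_span A (c *: x)].
Proof.
split=> [|_ _ [n [c [v [vA ->]]]] [m [d [w [wA ->]]]]|c _ [n [d [v [vA ->]]]]].
- by exists 0%N, (fun=> 0), (fun=> 0); split; [case | rewrite big_ord0].
- pose glue T (f : 'I_n -> T) (g : 'I_m -> T) i :=
    match fintype.split i with inl j => f j | inr j => g j end.
  exists (n + m)%N, (glue _ c d), (glue _ v w); split.
    by move=> i; rewrite /glue; case: fintype.split.
  rewrite big_split_ord; congr (_ + _); apply: eq_bigr => i _; rewrite /glue.
    by rewrite -[lshift _ _]/(unsplit (inl i)) unsplitK.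
  by rewrite -[rshift _ _]/(unsplit (inr i)) unsplitK.
- exists n, (fun i => c * d i), v; split=> //.
  by rewrite scaler_sumr; apply: eq_bigr => i _; rewrite scalerA.
Qed.

Lemma closure_qf (ip : {dot U for sconj R k}) (A : set U) (x : U) :
  (forall e, 0 < e -> exists2 m, A m & qf ip (x - m) <= e) ->
  closure (A : set (normed_by ip)) x.
Proof.
move=> near_x B /nbhs_ballP[_ /gt0_emb[r r0 ->] rB].
have [m Am xm] := near_x (r ^+ 2 / 2) (divr_gt0 (exprn_gt0 2 r0) (ltr0n _ 2)).
exists m; split=> //; apply: rB; apply/ip_ballE; first exact: ltW.
by rewrite (le_lt_trans xm)// ltr_pdivrMr// ltr_pMr ?exprn_gt0// ltr1n.
Qed.

End Spans.

(** * Blocks *)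

Section Blocks.
Variables (R : realType) (k : scalar_kind) (X : choiceType) (S : Type).
Variables (Xs : S -> set X) (H : X -> hilbertSpace R k).
Local Notation F := (scalarField R k).
Local Notation conj := (sconj R k).
Implicit Types (K L : opKernel H).

Lemma partially_positiveP K :
  partially_positive Xs K <-> forall s, positive (block_kernel (Xs s) K).
Proof.
split=> [[hK pK] s|pK].
  by split; [exact: hK | exact/(psd_gramP (hK s)).1].
split=> s; first exact: (pK s).1.
by apply/(psd_gramP (pK s).1); exact: (pK s).2.
Qed.

Variables (P : partition [set: S] Xs [set: X]).
Variables (a : X -> S) (aP : forall x, Xs (a x) x).

Lemma block_index s x : Xs s x -> a x = s.
Proof.
by move=> sx; case: P => _ tI _; apply: tI => //; exists x; split; [exact: aP|].
Qed.

(** No condition ties the blocks together, so kernels given blockwise extend by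
    zero to all of [X]. *)
Lemma glue_kernels (Ls : forall s, opKernel (block_bundle (Xs s) H)) :
  exists L : opKernel H, forall s, block_kernel (Xs s) L = Ls s.
Proof.
pose L : opKernel H := fun x y =>
  if pselect (Xs (a x) y) is left m
  then (Ls (a x) (exist _ x (mem_set (aP x))) (exist _ y (mem_set m)) : boundedOp (H y) (H x))
  else 0.
exists L => s; apply: kernelP => -[x mx] [y my]; rewrite /block_kernel /L /=.
have e : a x = s by apply: block_index; exact: set_mem.
case: s / e mx my => mx my; case: pselect => [m|]; last by have := set_mem my.
by rewrite (bool_irrelevance (mem_set (aP x)) mx) (bool_irrelevance (mem_set m) my).
Qed.

Lemma fsym_adjoint (V : lmodType F) (b : {hermitian_sym V for conj})
  (J : fundamentalSymmetry b) x y : b (J x) y = b x (J y).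
Proof.
by rewrite -fsym_innerE ipC fsym_innerE -(hformC (hermitian_hform b)).
Qed.

Lemma fsym_form (V : lmodType F) (b : {hermitian_sym V for conj})
  (J : fundamentalSymmetry b) x y : b x y = fsym_inner J (J x) y.
Proof. by rewrite fsym_innerE fsymK. Qed.

Lemma fsym_qf (V : lmodType F) (b : {hermitian_sym V for conj})
  (J : fundamentalSymmetry b) x : qf (fsym_inner J) (J x) = qf (fsym_inner J) x.
Proof. by rewrite /qf !fsym_innerE fsymK fsym_adjoint. Qed.

Section Linearizations.
Variables (KK : S -> kreinSpace R k) (V : forall x, {linear H x -> KK (a x)}).
Implicit Types J : forall s, fundamentalSymmetry (kform (KK s)).

Lemma op_at_bounded J s x (e : a x = s) : bounded_bundle V J ->
  exists2 T : {linear H x -> KK s}, (T : H x -> KK s) = op_at V e &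
    is_bounded (inner (H x)) (fsym_inner (J s)) T.
Proof. by case: s / e => bV; exists (V x). Qed.

(** Passing from the form identity to the operator identity requires adjoints
    of the [V_x], supplied by the Riesz theorem through [adjoint_exists]. *)
Lemma linearizes_formP J (K : opKernel H) : bounded_bundle V J ->
  linearizes V J K <-> linearizes_form V K.
Proof.
move=> bV; split=> [lin s x y ex ey h l|lin s x y ex ey].
  have [T' adj ->] := lin s x y ex ey.
  by rewrite ipC -adj -ipC -fsym_form.
have [T TE bT] := op_at_bounded ex bV; have [T' adj] := adjoint_exists bT.
exists T'; first by move=> u w; rewrite -TE; exact: adj.
move=> l; apply/eqP; rewrite -subr_eq0; apply/eqP/(@ip_eq0 _ _ _ (inner (H x))).
set h := _ - _; rewrite {1}/h linearBl /= (lin s x y ex ey).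
by rewrite [inner _ (T' _) _]ipC -adj -ipC -fsym_form TE subrr.
Qed.

(** On the block [s] both Gram values are those of the vector
    [w u = sum of the V_x h]: [gramq L u] is its squared norm and [gramq K u] is
    [<J (w u), w u>]; the latter is smaller since [J] is isometric. *)
Lemma linearization_bound J (K : opKernel H) : bounded_bundle V J ->
  linearizes V J K -> exists L : opKernel H, partially_positive Xs L /\
    partial_le Xs (- L) K /\ partial_le Xs K L.
Proof.
move=> bV linJ; have lin := (linearizes_formP K bV).1 linJ.
suff bound s : exists L : opKernel (block_bundle (Xs s) H), [/\ positive L,
    positive (block_kernel (Xs s) K + L) & positive (L - block_kernel (Xs s) K)].
  have [L LE] := glue_kernels (fun s => projT1 (cid (bound s))).
  exists L; rewrite /partial_le opprK !partially_positiveP.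
  have addE K' L' s : block_kernel (Xs s) (K' + L') =
    block_kernel (Xs s) K' + block_kernel (Xs s) L' by [].
  have subE K' L' s : block_kernel (Xs s) (K' - L') =
    block_kernel (Xs s) K' - block_kernel (Xs s) L' by [].
  by split=> [s|]; [|split=> s]; rewrite ?addE ?subE LE; case: cid => ? [].
have idx (x : Xs s) : a (val x) = s by apply: block_index; exact: set_mem (valP x).
pose v x h := op_at V (idx x) h.
pose T' x := projT1 (cid2 (linJ s _ _ (idx x) (idx x))).
have T'P x : is_adjoint (inner (H (val x))) (fsym_inner (J s)) (v x) (T' x).
  by rewrite /T'; case: cid2.
have [|L LE] := @kernel_of_adjoints _ _ _ (block_bundle (Xs s) H) (fun x y h => T' x (v y h)).
  by move=> x y h l; rewrite ipC -T'P -ipC T'P.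
have hL : hermitian_kernel L by move=> x y h l; rewrite !LE ipC -T'P -ipC T'P.
have hK : hermitian_kernel (block_kernel (Xs s) K).
  move=> x y h l; rewrite /block_kernel [RHS]ipC (lin s _ _ (idx x) (idx y)).
  by rewrite (lin s _ _ (idx y) (idx x)) -(hformC (hermitian_hform _)).
pose w (u : combo (block_bundle (Xs s) H)) := \sum_(p <- u) v (tag p) (tagged p).
have gL u : gramq L u = qf (fsym_inner (J s)) (w u).
  rewrite /gramq gramE /qf hform_sum//; congr (re _).
  by do 2!apply: eq_bigr => ? _; rewrite LE ipC -T'P -ipC.
have gK u : gramq (block_kernel (Xs s) K) u = re (fsym_inner (J s) (J s (w u)) (w u)).
  rewrite /gramq gramE -fsym_form hform_sum//; congr (re _).
  by do 2!apply: eq_bigr => ? _; rewrite /block_kernel (lin s _ _ (idx _) (idx _)).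
have le u : `|gramq (block_kernel (Xs s) K) u| <= gramq L u.
  rewrite -(ler_pXn2r (isT : (0 < 2)%N)) ?nnegrE ?gL//.
  rewrite real_normK ?num_real// gK [leRHS]expr2 -{1}fsym_qf.
  exact: re_hform_cs.
exists L; split; (split=> [|u]; [by do ?[exact: hermitianD | exact: hermitianB] |]).
- by rewrite gL.
- by rewrite gramqD; have := le u; rewrite ler_norml => /andP[]; lra.
- by rewrite gramqB; have := le u; rewrite ler_norml => /andP[]; lra.
Qed.

End Linearizations.

(** The kernel sections of a reproducing kernel Krein space linearize its
    kernel; point evaluations composed with [J] are the adjoints, whence
    boundedness for every [J], and density because only [0] vanishes at all
    points. *)
Theorem linearization_of_krein (K : opKernel H)
    (RR : forall s, submodClosed (sections (block_bundle (Xs s) H)))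
    (b : forall s, {hermitian_sym (subspace_of (RR s)) for conj}) :
  (forall s, krein_form (b s) /\ reproducing (block_kernel (Xs s) K) (b s)) ->
  exists (KK : S -> kreinSpace R k) (V : forall x, {linear H x -> KK (a x)}),
    forall J : forall s, fundamentalSymmetry (kform (KK s)),
      [/\ bounded_bundle V J, linearizes V J K & minimal_bundle V J].
Proof.
move=> bP; pose KK s := KreinSpace (bP s).1.
pose pt x : Xs (a x) := exist _ x (mem_set (aP x)).
have ksE s y (h h' : H (val y)) c :
    kernel_section (block_kernel (Xs s) K) (c *: h + h' : block_bundle (Xs s) H y) =
    c *: kernel_section (block_kernel (Xs s) K) (h : block_bundle (Xs s) H y) +
    kernel_section (block_kernel (Xs s) K) (h' : block_bundle (Xs s) H y).
  by apply: functional_extensionality_dep => z; exact: (linearP (block_kernel (Xs s) K z y)).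
pose V0 x (h : H x) : KK (a x) :=
  projT1 (cid2 ((bP (a x)).2 (pt x) (h : block_bundle (Xs (a x)) H (pt x)))).
have V0E x (h : H x) : val (V0 x h : subspace_of (RR (a x))) =
    kernel_section (block_kernel (Xs (a x)) K) (h : block_bundle (Xs (a x)) H (pt x)).
  by rewrite /V0; case: cid2.
have V0P x (h : H x) (f : subspace_of (RR (a x))) :
    inner (H x) (val f (pt x)) h = b (a x) f (V0 x h).
  by rewrite /V0; case: cid2.
have lV x : linear (@V0 x).
  move=> c h h'; apply: val_inj; rewrite V0E.
  have -> : val (c *: V0 x h + V0 x h' : subspace_of (RR (a x))) =
    c *: val (V0 x h : subspace_of (RR (a x))) + val (V0 x h' : subspace_of (RR (a x))) by [].
  by rewrite !V0E; exact: ksE.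
pose V x : {linear H x -> KK (a x)} :=
  HB.pack (@V0 x) (GRing.isLinear.Build _ _ _ _ _ (lV x)).
exists KK, V => J.
have adj x : is_adjoint (inner (H x)) (fsym_inner (J (a x))) (V x)
    (fun f => val (J (a x) f : subspace_of (RR (a x))) (pt x)).
  move=> h f; rewrite fsym_innerE fsym_adjoint (hformC (hermitian_hform _)) /= -V0P.
  by rewrite -ipC.
have bV : bounded_bundle V J.
  move=> x; apply/is_boundedP; apply: (hellinger_toeplitz _ _ _ _ _ (adj x)) => //.
  by apply: qcomplete_ip; exact: fsym_complete.
split=> //.
  apply/(linearizes_formP _ bV) => s x y ex ey h l.
  case: s / ex ey => ey.
  have opE z (e : a z = a x) (mz : z \in Xs (a x)) (g : H z) :
      val (op_at V e g : subspace_of (RR (a x))) = kernel_section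
        (block_kernel (Xs (a x)) K) (g : block_bundle (Xs (a x)) H (exist _ z mz)).
    move: (a x) e mz => s e; case: s / e => mz.
    by rewrite /op_at /= V0E /pt (bool_irrelevance (mem_set (aP z)) mz).
  have my : y \in Xs (a x) by apply: mem_set; rewrite -ey.
  rewrite /op_at /= -[RHS](V0P x h (op_at V ey l)) (opE _ _ my).
  by [].
have evalE s (g : KK s) z (mz : z \in Xs s) (e : a z = s) (h : H z) :
    inner (H z) (val (g : subspace_of (RR s)) (exist _ z mz)) h = b s g (op_at V e h).
  case: s / e g mz => g mz; rewrite [RHS]/= -V0P.
  by rewrite /pt (bool_irrelevance (mem_set (aP z)) mz).
move=> s; rewrite -subTset => f _; apply: closure_qf => e e0.
have [M0 MD MZ] := linear_span_closed (@ranges_at _ _ _ _ _ _ _ V s).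
apply: (dense_subspace (B := fsym_inner (J s))) => //.
  by apply: qcomplete_ip; exact: fsym_complete.
move=> v vM.
suff Jv : J s v = 0 by rewrite -[v](fsymK (J s)) Jv linear0.
apply: val_inj; apply: functional_extensionality_dep => -[z mz].
have ez : a z = s by apply: block_index; exact: set_mem.
apply: (@ip_eq0 _ _ _ (inner (H z))); rewrite (evalE _ _ _ _ ez) -fsym_innerE.
apply: vM; exists 1%N, (fun=> 1).
exists (fun=> op_at V ez (val (J s v : subspace_of (RR s)) (exist _ z mz))).
by rewrite big_ord1 scale1r; split=> // _; exists z, ez; eexists.
Qed.

End Blocks.

(** * The equivalences *)

Theorem theorem4p14 (R : realType) (k : scalar_kind)
    (X : choiceType) (S : Type) (Xs : S -> set X)
    (X_nonempty : [set: X] !=set0)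
    (P : partition [set: S] Xs [set: X])
    (a : X -> S) (aP : forall x, Xs (a x) x)
    (H : X -> hilbertSpace R k)
    (K : opKernel H) (Kherm : partially_hermitian Xs K) :
  [<->
    (* (1) *)
    exists L : opKernel H, partially_positive Xs L /\
      partial_le Xs (- L) K /\ partial_le Xs K L;
    (* (1)' *)
    exists L : opKernel H, partially_positive Xs L /\ partial_le Xs K L;
    (* (2) *)
    exists L : opKernel H, partially_positive Xs L /\
      forall s (f g : sections (block_bundle (Xs s) H)),
        finitely_supported f -> finitely_supported g ->
        `|kernel_form (block_kernel (Xs s) K) f g| <=
          ssqrt (kernel_form (block_kernel (Xs s) L) f f) *
          ssqrt (kernel_form (block_kernel (Xs s) L) g g);
    (* (3) *)
    exists K1 K2 : opKernel H,
      [/\ partially_positive Xs K1, partially_positive Xs K2 & K = K1 - K2];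
    (* (3)' *)
    exists K1 K2 : opKernel H,
      [/\ partially_positive Xs K1, partially_positive Xs K2,
          disjoint_kernels Xs K1 K2 & K = K1 - K2];
    (* (4) *)
    exists (KK : S -> kreinSpace R k) (V : forall x, {linear H x -> KK (a x)}),
      forall J : forall s, fundamentalSymmetry (kform (KK s)),
        [/\ bounded_bundle V J, linearizes V J K & minimal_bundle V J];
    (* (5) *)
    exists (RR : forall s, submodClosed (sections (block_bundle (Xs s) H)))
           (b : forall s, {hermitian_sym (subspace_of (RR s)) for @sconj R k}),
      forall s, krein_form (b s) /\ reproducing (block_kernel (Xs s) K) (b s)
  ] /\
  (* the two formulations of (LL2) agree *)
  (forall (KK : S -> kreinSpace R k) (V : forall x, {linear H x -> KK (a x)})
          (J : forall s, fundamentalSymmetry (kform (KK s))),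
     bounded_bundle V J -> (linearizes V J K <-> linearizes_form V K)).
Proof.
split; last by move=> KK V J; exact: linearizes_formP.
set P1 := (X in [<-> X; _; _; _; _; _; _]).
set P1' := (X in [<-> _; X; _; _; _; _; _]).
set P2 := (X in [<-> _; _; X; _; _; _; _]).
set P3 := (X in [<-> _; _; _; X; _; _; _]).
set P3' := (X in [<-> _; _; _; _; X; _; _]).
set P4 := (X in [<-> _; _; _; _; _; X; _]).
set P5 := (X in [<-> _; _; _; _; _; _; X]).
have bpos L := @partially_positiveP R k X S Xs H L.
have i11' : P1 -> P1' by move=> [L [pL [_ KL]]]; exists L.
have i1'3 : P1' -> P3.
  by move=> [L [pL KL]]; exists L, (L - K); split=> //; rewrite opprB addrC subrK.
have i31 : P3 -> P1.
  move=> [K1 [K2 [/bpos p1 /bpos p2 KE]]]; exists (K1 + K2).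
  rewrite /partial_le !bpos; split=> [s|]; first exact: positiveD (p1 s) (p2 s).
  have two_pos K' : (forall s, positive (block_kernel (Xs s) K')) ->
      forall s, positive (block_kernel (Xs s) (K' + K')).
    by move=> p s; exact: positiveD (p s) (p s).
  split=> s.
    rewrite opprK (_ : _ + _ = K1 + K1); first exact: two_pos.
    by rewrite KE addrC addrACA subrr addr0.
  rewrite (_ : _ - _ = K2 + K2); first exact: two_pos.
  by rewrite KE opprB addrC addrA subrK.
have i12 : P1 -> P2.
  move=> [L [pL [/bpos LK /bpos KL]]]; exists L; split=> // s.
  apply/form_boundP; [exact: Kherm | exact: (bpos L).1 pL s|split].
    by have := LK s; rewrite opprK.
  exact: KL.
have i21 : P2 -> P1.
  move=> [L [pL bd]]; exists L; split=> //.
  rewrite /partial_le !bpos opprK; split=> s;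
    by have [] := (form_boundP (Kherm s) ((bpos L).1 pL s)).1 (bd s).
have i33' : P3 -> P3'.
  move=> [K1 [K2 [/bpos p1 /bpos p2 KE]]].
  pose M s := projT1 (cid (maximal_common_part (p1 s) (p2 s))).
  have MP s : [/\ positive (block_kernel (Xs s) K1 - M s),
      positive (block_kernel (Xs s) K2 - M s) & forall L, positive L ->
      positive (block_kernel (Xs s) K1 - M s - L) ->
      positive (block_kernel (Xs s) K2 - M s - L) -> L = 0].
    by rewrite /M; case: cid.
  have [N NE] := glue_kernels P aP M.
  have NB K' s : block_kernel (Xs s) (K' - N) = block_kernel (Xs s) K' - M s.
    by rewrite -NE.
  exists (K1 - N), (K2 - N); split.
  - by apply/bpos => s; rewrite NB; have [] := MP s.
  - by apply/bpos => s; rewrite NB; have [] := MP s.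
  - move=> L /bpos pL /bpos L1 /bpos L2 s; have [_ _] := MP s; apply=> //.
      by rewrite -NB; exact: L1.
    by rewrite -NB; exact: L2.
  - by rewrite KE opprB addrA subrK.
have i3'5 : P3' -> P5.
  move=> [K1 [K2 [p1 p2 dis KE]]].
  (* A common minorant on one block, extended by 0 to the others, is a global
     one. *)
  have blk s : forall L, positive L -> positive (block_kernel (Xs s) K1 - L) ->
      positive (block_kernel (Xs s) K2 - L) -> L = 0.
    move=> L pL L1 L2; have [N NE] := glue_kernels P aP (fun s' =>
      if pselect (s = s') is left e
      then ecast t (opKernel (block_bundle (Xs t) H)) e L else 0).
    have NsE : block_kernel (Xs s) N = L.
      by rewrite NE; case: pselect => // e; rewrite (Prop_irrelevance e erefl).
    have N0 s' : s <> s' -> block_kernel (Xs s') N = 0.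
      by move=> ss'; rewrite NE; case: pselect.
    have sub K' : partially_positive Xs K' ->
        positive (block_kernel (Xs s) K' - L) -> partial_le Xs N K'.
      move=> /bpos pK' le; apply/bpos => s'.
      have -> : block_kernel (Xs s') (K' - N) =
        block_kernel (Xs s') K' - block_kernel (Xs s') N by [].
      have [<-|/N0 ->] := pselect (s = s'); first by rewrite NsE.
      by rewrite subr0; exact: pK'.
    rewrite -NsE; apply: dis; [|exact: sub|exact: sub].
    apply/bpos => s'; have [<-|/N0 ->] := pselect (s = s'); first by rewrite NsE.
    exact: positive0.
  have kr s := krein_of_disjoint ((bpos _).1 p1 s) ((bpos _).1 p2 s) (@blk s).
  exists (fun s => projT1 (cid (kr s))).
  exists (fun s => projT1 (cid (projT2 (cid (kr s))))) => s.
  by rewrite KE; case: (cid (projT2 (cid (kr s)))).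
have i54 : P5 -> P4 by move=> [RR [b bP]]; exact: linearization_of_krein bP.
have i41 : P4 -> P1.
  move=> [KK [V VP]].
  have fs s : exists j : fundamentalSymmetry (kform (KK s)), True.
    by have [j] := kformP (KK s); exists j.
  pose J s := projT1 (cid (fs s)).
  have [bV lV _] := VP J; exact: linearization_bound bV lV.
tfae; tauto.
Qed.
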